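(* Let $R$ be a commutative unital coherent ring, let $\mathcal{C}$ be an $R$-saturated $R$-linear triangulated category, and let $w$ be a bounded weight structure on it. Then the following statements are valid. 1. For any $i\in\mathbb{Z}$ and $M\in\operatorname{Obj}\mathcal{C}$ the functors $\tau_{\le i}(H_M)$ and $\tau_{\ge i}(H_M)$ are representable, where $H_M=\mathcal{C}(-,M)$. 2. There exists a $t$-structure $t$ right adjacent to $w$. Moreover, $t$ is bounded if $\mathcal{C}$ is densely generated by a single object $G$. 3. The heart $\underline{Ht}$ is naturally equivalent to the category $\mathrm{Fun}_R(\underline{Hw}^{op},R\text{-}\mathrm{mod})$ of $R$-linear functors from $\underline{Hw}^{op}$ into finitely presented $R$-modules.
   Context: For classes of objects $A,B$ write $A\perp B$ if every morphism from an object of $A$ to an object of $B$ is zero. A weight structure $w$ on a triangulated category $\mathcal{C}$ is a pair of classes $\mathcal{C}_{w\le 0},\mathcal{C}_{w\ge 0}\subset \operatorname{Obj}\mathcal{C}$, both closed under retracts, such that $\mathcal{C}_{w\le 0}\subset \mathcal{C}_{w\le 0}[1]$, $\mathcal{C}_{w\ge 0}[1]\subset \mathcal{C}_{w\ge 0}$, $\mathcal{C}_{w\le 0}\perp \mathcal{C}_{w\ge 0}[1]$, and every object $M$ fits into a distinguished triangle $L\to M\to R\to L[1]$ with $L\in \mathcal{C}_{w\le 0}$, $R\in \mathcal{C}_{w\ge 0}[1]$. Put $\mathcal{C}_{w\le i}=\mathcal{C}_{w\le 0}[i]$, $\mathcal{C}_{w\ge i}=\mathcal{C}_{w\ge 0}[i]$;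 the heart $\underline{Hw}$ is the full subcategory on $\mathcal{C}_{w\le 0}\cap\mathcal{C}_{w\ge 0}$. $w$ is bounded if $\bigcup_i\mathcal{C}_{w\ge i}=\operatorname{Obj}\mathcal{C}=\bigcup_i\mathcal{C}_{w\le i}$. An $m$-weight decomposition of $M$ is a distinguished triangle $w_{\le m}M\to M\to w_{\ge m+1}M\to (w_{\le m}M)[1]$ with $w_{\le m}M\in \mathcal{C}_{w\le m}$, $w_{\ge m+1}M\in\mathcal{C}_{w\ge m+1}$ (it exists but is not canonical). For $m<n$ and fixed $m$- and $n$-weight decompositions of $M$, there is a unique morphism of triangles from the former to the latter extending $\mathrm{id}_M$, giving connecting morphisms $w_{\le m}M\to w_{\le n}M$ and $w_{\ge m+1}M\to w_{\ge n+1}M$. For a cohomological functor $H$ on $\mathcal{C}$ and $n\in\mathbb{Z}$: $\tau_{\le n}(H)(M)=\operatorname{Im}(H(w_{\le n+1}M)\to H(w_{\le n}M))$ and $\tau_{\ge n}(H)(M)=\operatorname{Im}(H(w_{\ge n}M)\to H(w_{\ge n-1}M))$ (well-defined cohomological functors). A $t$-structure $t$ on $\mathcal{C}$ (homological convention) is a pair of isomorphism-closed classes $\mathcal{C}_{t\le 0},\mathcal{C}_{t\ge 0}$ with $\mathcal{C}_{t\le 0}\subset \mathcal{C}_{t\le 0}[1]$, $\mathcal{C}_{t\ge 0}[1]\subset \mathcal{C}_{t\ge 0}$, $\mathcal{C}_{t\ge 0}[1]\perp \mathcal{C}_{t\le 0}$, and such that every $M$ fits into a distinguished triangle $L\to M\to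 R\to L[1]$ with $L\in \mathcal{C}_{t\ge 0}$, $R\in \mathcal{C}_{t\le 0}[-1]$. The heart $\underline{Ht}$ is the full subcategory on $\mathcal{C}_{t\le 0}\cap\mathcal{C}_{t\ge 0}$. $t$ is bounded if $\bigcup_i\mathcal{C}_{t\ge 0}[i]=\operatorname{Obj}\mathcal{C}=\bigcup_i\mathcal{C}_{t\le 0}[i]$. $t$ is right adjacent to $w$ if $\mathcal{C}_{t\ge 0}=\mathcal{C}_{w\ge 0}$. A ring is coherent if each of its finitely generated ideals is finitely presented. An $R$-linear cohomological functor $H$ from $\mathcal{C}$ into $R\text{-}\mathrm{Mod}$ is finite if for every $M\in \operatorname{Obj}\mathcal{C}$ the $R$-module $H(M)$ is finitely presented and $H(M[-i])=0$ for $i\ll 0$ and for $i\gg 0$. $\mathcal{C}$ is $R$-saturated if the representable functors $\mathcal{C}^{op}\to R\text{-}\mathrm{Mod}$ are exactly all the finite ones. $\mathcal{C}$ is densely generated by $G$ if $\mathcal{C}$ is the smallest full retraction-closed triangulated subcategory of itself containing $G$. *)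

(* Defs.v *)
From HB Require Import structures.
From mathcomp Require Import all_boot all_order all_algebra.
From mathcomp Require Import boolp.
From mathcomp Require Import zify.

Set Implicit Arguments.
Unset Strict Implicit.
Unset Printing Implicit Defensive.

Import Order.TTheory GRing.Theory Num.Theory.
Local Open Scope ring_scope.

Declare Scope cat_scope.
Delimit Scope cat_scope with cat.

Record category := Category {
  obj :> Type;
  hom : obj -> obj -> Type;
  idm : forall X, hom X X;
  comp : forall X Y Z, hom Y Z -> hom X Y -> hom X Z;
  compA : forall X Y Z T (h : hom Z T) (g : hom Y Z) (f : hom X Y),
    comp h (comp g f) = comp (comp h g) f;
  comp1m : forall X Y (f : hom X Y), comp (idm Y) f = f;
  compm1 : forall X Y (f : hom X Y), comp f (idm X) = f }.

Arguments hom {c} X Y.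
Arguments idm {c} X.
Arguments comp {c X Y Z} g f : rename.
Notation "g \oc f" := (comp g f) (at level 50, left associativity) : cat_scope.
Local Open Scope cat_scope.

Definition is_inverse (C : category) (X Y : C) (f : hom X Y) (g : hom Y X) :=
  g \oc f = idm X /\ f \oc g = idm Y.

Definition is_iso (C : category) (X Y : C) (f : hom X Y) :=
  exists g, is_inverse f g.

Definition isomorphic (C : category) (X Y : C) :=
  exists f : hom X Y, is_iso f.

Definition retract (C : category) (X Y : C) :=
  exists (i : hom X Y) (p : hom Y X), p \oc i = idm X.

Definition op_cat (C : category) : category :=
  @Category (obj C) (fun X Y => @hom C Y X) (@idm C)
    (fun X Y Z g f => f \oc g)
    (fun X Y Z T h g f => esym (compA f g h))
    (fun X Y f => compm1 f) (fun X Y f => comp1m f).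

Definition full_cat (C : category) (P : C -> Prop) : category :=
  @Category {X : C | P X} (fun X Y => hom (sval X) (sval Y))
    (fun X => idm (sval X)) (fun X Y Z g f => g \oc f)
    (fun X Y Z T h g f => compA h g f)
    (fun X Y f => comp1m f) (fun X Y f => compm1 f).

Record functor (C D : category) := Functor {
  fobj :> C -> D;
  fmap : forall X Y, hom X Y -> hom (fobj X) (fobj Y);
  fmap1 : forall X, fmap (idm X) = idm (fobj X);
  fmapM : forall X Y Z (g : hom Y Z) (f : hom X Y),
    fmap (g \oc f) = fmap g \oc fmap f }.

Arguments fmap {C D} F {X Y} f : rename.

Definition fid (C : category) : functor C C :=
  @Functor C C id (fun X Y f => f) (fun X => erefl) (fun X Y Z g f => erefl).

Lemma fcomp1 (C D E : category) (G : functor D E) (F : functor C D) X :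
  fmap G (fmap F (idm X)) = idm (G (F X)).
Proof. by rewrite !fmap1. Qed.

Lemma fcompM (C D E : category) (G : functor D E) (F : functor C D) X Y Z
    (g : hom Y Z) (f : hom X Y) :
  fmap G (fmap F (g \oc f)) = fmap G (fmap F g) \oc fmap G (fmap F f).
Proof. by rewrite !fmapM. Qed.

Definition fcomp (C D E : category) (G : functor D E) (F : functor C D) :
    functor C E :=
  @Functor C E (fun X => G (F X)) (fun X Y f => fmap G (fmap F f))
    (fcomp1 G F) (fcompM G F).

Definition incl (C : category) (P : C -> Prop) : functor (full_cat P) C :=
  @Functor (full_cat P) C sval (fun X Y f => f)
    (fun X => erefl) (fun X Y Z g f => erefl).

Record nat_trans (C D : category) (F G : functor C D) := NatTrans {
  ncomp :> forall X, hom (F X) (G X);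
  naturality : forall X Y (f : hom X Y),
    ncomp Y \oc fmap F f = fmap G f \oc ncomp X }.

Lemma nat_transP (C D : category) (F G : functor C D) (a b : nat_trans F G) :
  (forall X, a X = b X) -> a = b.
Proof.
case: a b => [a na] [b nb] /= ab.
have e : a = b by apply: functional_extensionality_dep.
by subst b; congr NatTrans; apply: Prop_irrelevance.
Qed.

Definition nat_id (C D : category) (F : functor C D) : nat_trans F F.
Proof.
by exists (fun X => idm (F X)) => X Y f; rewrite comp1m compm1.
Defined.

Definition nat_comp (C D : category) (F G H : functor C D)
    (b : nat_trans G H) (a : nat_trans F G) : nat_trans F H.
Proof.
exists (fun X => b X \oc a X) => X Y f.
by rewrite -compA naturality compA naturality compA.
Defined.

Definition functor_cat (C D : category) : category.
Proof.
refine (@Category (functor C D) (@nat_trans C D) (@nat_id C D)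
  (@nat_comp C D) _ _ _).
- by move=> *; apply: nat_transP => X /=; rewrite compA.
- by move=> *; apply: nat_transP => X /=; rewrite comp1m.
- by move=> *; apply: nat_transP => X /=; rewrite compm1.
Defined.

Definition nat_isomorphic (C D : category) (F G : functor C D) :=
  exists a : nat_trans F G, forall X, is_iso (a X).

Definition quasi_inverse (C D : category) (F : functor C D) (G : functor D C) :=
  nat_isomorphic (fcomp G F) (fid C) /\ nat_isomorphic (fcomp F G) (fid D).

Definition is_equivalence (C D : category) (F : functor C D) :=
  exists G : functor D C, quasi_inverse F G.

Section Isomorphisms.
Variable C : category.
Implicit Types X Y Z : C.

Lemma iso_refl X : isomorphic X X.
Proof. by exists (idm X), (idm X); split; rewrite comp1m. Qed.

Lemma iso_sym X Y : isomorphic X Y -> isomorphic Y X.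
Proof. by move=> [f [g [gf fg]]]; exists g, f. Qed.

Lemma iso_trans X Y Z : isomorphic X Y -> isomorphic Y Z -> isomorphic X Z.
Proof.
move=> [f [g [gf fg]]] [h [k [kh hk]]]; exists (h \oc f), (g \oc k); split.
  by rewrite -compA (compA k) kh comp1m.
by rewrite -compA (compA f) fg comp1m.
Qed.

Lemma fmap_iso (D : category) (F : functor C D) X Y :
  isomorphic X Y -> isomorphic (F X) (F Y).
Proof.
move=> [f [g [gf fg]]]; exists (fmap F f), (fmap F g).
by split; rewrite -fmapM ?gf ?fg fmap1.
Qed.

Lemma nat_iso_faithful (F : functor C C) X Y (f g : hom X Y) :
  nat_isomorphic F (fid C) -> fmap F f = fmap F g -> f = g.
Proof.
move=> [a isoa] e; have [b [_ ab]] := isoa X.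
have := naturality a f; rewrite e naturality /= => /(congr1 (comp ^~ b)).
by rewrite -!compA ab !compm1.
Qed.

End Isomorphisms.

Lemma quasi_inverse_sym (C D : category) (F : functor C D) (G : functor D C) :
  quasi_inverse F G -> quasi_inverse G F.
Proof. by case. Qed.

Lemma quasi_inverse_faithful (C D : category) (F : functor C D)
    (G : functor D C) X Y (f g : hom X Y) :
  quasi_inverse F G -> fmap F f = fmap F g -> f = g.
Proof.
by move=> [GF _] e; apply: (nat_iso_faithful GF); rewrite /= e.
Qed.

Lemma quasi_inverse_full (C D : category) (F : functor C D)
    (G : functor D C) X Y (k : hom (F X) (F Y)) :
  quasi_inverse F G -> exists f : hom X Y, fmap F f = k.
Proof.
move=> FG; have [[a isoa] _] := FG.
have [b [ba ab]] := isoa X; have [c [ca ac]] := isoa Y.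
exists (a Y \oc fmap G k \oc b).
apply: (quasi_inverse_faithful (quasi_inverse_sym FG)).
have /(congr1 (comp c)) := naturality a (a Y \oc fmap G k \oc b).
rewrite compA ca comp1m /= => ->.
by rewrite -!compA ba compm1 compA ca comp1m.
Qed.

Lemma linearP_ext (R : comPzRingType) (U V : lmodType R)
    (f g : {linear U -> V}) : f =1 g -> f = g.
Proof.
case: f g => [f [[fD] [fZ]]] [g [[gD] [gZ]]] /= /funext fg; subst g.
by rewrite (Prop_irrelevance fD gD) (Prop_irrelevance fZ gZ).
Qed.

Definition lin_id (R : comPzRingType) (U : lmodType R) : {linear U -> U} :=
  idfun.

Definition lin_comp (R : comPzRingType) (U V W : lmodType R)
    (g : {linear V -> W}) (f : {linear U -> V}) : {linear U -> W} := g \o f.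

Definition Mod (R : comPzRingType) : category.
Proof.
refine (@Category (lmodType R) (fun U V => {linear U -> V}) (@lin_id R)
  (@lin_comp R) _ _ _); by move=> *; apply: linearP_ext.
Defined.

Section LinearImage.
Variables (R : comPzRingType) (U V : lmodType R) (f : {linear U -> V}).

Definition in_image : pred V := fun y => `[< exists x, f x = y >].

Lemma in_image_submod_closed : submod_closed in_image.
Proof.
split=> [|a y z]; first by apply/asboolP; exists 0; rewrite linear0.
move=> /asboolP[x <-] /asboolP[x' <-]; apply/asboolP.
by exists (a *: x + x'); rewrite linearP.
Qed.

HB.instance Definition _ :=
  GRing.isSubmodClosed.Build R V in_image in_image_submod_closed.

Record image_type := ImageElt { image_val : V; _ : image_val \in in_image }.

HB.instance Definition _ := [isSub for image_val].
HB.instance Definition _ := [Choice of image_type by <:].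
HB.instance Definition _ := [SubChoice_isSubLmodule of image_type by <:].

Definition image_mod : lmodType R := image_type.

Lemma image_modP (y : image_mod) : exists x, f x = image_val y.
Proof. by case: y => y /= /asboolP. Qed.

Lemma image_val_inj : injective image_val.
Proof. exact: val_inj. Qed.

Lemma image_val_linear (a : R) (y z : image_mod) :
  image_val (a *: y + z) = a *: image_val y + image_val z.
Proof. exact: (linearP (val : image_mod -> V)). Qed.

End LinearImage.

Section ImageMap.
Variables (R : comPzRingType) (U V U' V' : lmodType R).
Variables (f : {linear U -> V}) (f' : {linear U' -> V'}) (h : {linear V -> V'}).
Hypothesis hP : forall x, exists x', f' x' = h (f x).

Lemma image_map_subproof (y : image_mod f) : h (image_val y) \in in_image f'.
Proof.
by have [x <-] := image_modP y; apply/asboolP; apply: hP.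
Qed.

Definition image_map_fun (y : image_mod f) : image_mod f' :=
  ImageElt (image_map_subproof y).

Lemma image_map_is_linear : linear image_map_fun.
Proof.
move=> a y z; apply: image_val_inj.
by rewrite image_val_linear /= linearP.
Qed.

HB.instance Definition _ :=
  GRing.isLinear.Build R (image_mod f) (image_mod f') _ image_map_fun
    image_map_is_linear.

Definition image_map : {linear image_mod f -> image_mod f'} := image_map_fun.

Lemma image_mapE y : image_val (image_map y) = h (image_val y).
Proof. by []. Qed.

End ImageMap.

Definition finitely_presented (R : comPzRingType) (M : lmodType R) : Prop :=
  exists (m n : nat) (d : {linear 'rV[R]_m -> 'rV[R]_n})
    (e : {linear 'rV[R]_n -> M}),
    (forall y, exists x, e x = y) /\
    (forall x, e x = 0 <-> exists z, d z = x).

Section FinitelyGeneratedIdeal.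
Variables (R : comPzRingType) (n : nat) (a : 'I_n -> R).

Definition lin_comb (x : 'rV[R]_n) : R^o := \sum_(i < n) x 0 i * a i.

Lemma lin_comb_is_linear : linear lin_comb.
Proof.
move=> c x y; rewrite /lin_comb scaler_sumr -big_split /=.
by apply: eq_bigr => i _; rewrite !mxE mulrDl -mulrA.
Qed.

HB.instance Definition _ :=
  GRing.isLinear.Build R 'rV[R]_n R^o _ lin_comb lin_comb_is_linear.

(* The ideal (a_0, ..., a_{n-1}), as an R-module. *)
Definition fg_ideal : lmodType R := image_mod lin_comb.

End FinitelyGeneratedIdeal.

Definition coherent (R : comPzRingType) : Prop :=
  forall (n : nat) (a : 'I_n -> R), finitely_presented (fg_ideal a).

Definition fpMod (R : comPzRingType) : category :=
  @full_cat (Mod R) (@finitely_presented R).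

Record lincat (R : comPzRingType) := LinCat {
  lobj : Type;
  lhom : lobj -> lobj -> lmodType R;
  lid : forall X, lhom X X;
  lcomp : forall X Y Z, lhom Y Z -> lhom X Y -> lhom X Z;
  lcompA : forall X Y Z T (h : lhom Z T) (g : lhom Y Z) (f : lhom X Y),
    lcomp h (lcomp g f) = lcomp (lcomp h g) f;
  lcomp1m : forall X Y (f : lhom X Y), lcomp (lid Y) f = f;
  lcompm1 : forall X Y (f : lhom X Y), lcomp f (lid X) = f;
  lcompPl : forall X Y Z (a : R) (g g' : lhom Y Z) (f : lhom X Y),
    lcomp (a *: g + g') f = a *: lcomp g f + lcomp g' f;
  lcompPr : forall X Y Z (a : R) (g : lhom Y Z) (f f' : lhom X Y),
    lcomp g (a *: f + f') = a *: lcomp g f + lcomp g f' }.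

Arguments lhom {R} l X Y : rename.

Definition cat_of (R : comPzRingType) (C : lincat R) : category :=
  Category (@lcompA R C) (@lcomp1m R C) (@lcompm1 R C).
Coercion cat_of : lincat >-> category.

Definition full_lincat (R : comPzRingType) (C : lincat R) (P : C -> Prop) :
    lincat R :=
  @LinCat R {X : C | P X} (fun X Y => lhom C (sval X) (sval Y))
    (fun X => lid (sval X)) (fun X Y Z g f => lcomp g f)
    (fun _ _ _ _ h g f => lcompA h g f)
    (fun _ _ f => lcomp1m f) (fun _ _ f => lcompm1 f)
    (fun _ _ _ a g g' f => lcompPl a g g' f)
    (fun _ _ _ a g f f' => lcompPr a g f f').

Section LinearCategory.
Variables (R : comPzRingType) (C : lincat R).
Implicit Types X Y Z : C.

Definition zero_map X Y : hom X Y := (0 : lhom C X Y).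

Definition opp_map X Y (f : hom X Y) : hom X Y := - (f : lhom C X Y).

Definition add_map X Y (f g : hom X Y) : hom X Y :=
  (f : lhom C X Y) + (g : lhom C X Y).

Definition scale_map X Y (a : R) (f : hom X Y) : hom X Y :=
  a *: (f : lhom C X Y).

Definition is_zero Z :=
  forall X, (forall f : hom X Z, f = zero_map X Z) /\
            (forall f : hom Z X, f = zero_map Z X).

Definition is_biproduct X Y S :=
  exists (i : hom X S) (j : hom Y S) (p : hom S X) (q : hom S Y),
    [/\ p \oc i = idm X, q \oc j = idm Y,
        q \oc i = zero_map X Y, p \oc j = zero_map Y X
      & add_map (i \oc p) (j \oc q) = idm S].

Definition orthogonal (A B : C -> Prop) :=
  forall X Y (f : hom X Y), A X -> B Y -> f = zero_map X Y.

Definition linear_endo (F : functor C C) :=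
  forall X Y (a : R) (f g : hom X Y),
    fmap F (add_map (scale_map a f) g) =
    add_map (scale_map a (fmap F f)) (fmap F g).

Lemma compPl X Y Z (a : R) (g g' : hom Y Z) (f : hom X Y) :
  add_map (scale_map a g) g' \oc f =
  add_map (scale_map a (g \oc f)) (g' \oc f).
Proof. exact: lcompPl. Qed.

Lemma compPr X Y Z (a : R) (g : hom Y Z) (f f' : hom X Y) :
  g \oc add_map (scale_map a f) f' =
  add_map (scale_map a (g \oc f)) (g \oc f').
Proof. exact: lcompPr. Qed.

Lemma add0_map X Y (f : hom X Y) : add_map (zero_map X Y) f = f.
Proof. exact: add0r. Qed.

Lemma add_map0 X Y (f : hom X Y) : add_map f (zero_map X Y) = f.
Proof. exact: addr0. Qed.

Lemma scaleN1_map X Y (f : hom X Y) : scale_map (-1) f = opp_map f.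
Proof. exact: scaleN1r. Qed.

Lemma scale_map0 X Y a : scale_map a (zero_map X Y) = zero_map X Y.
Proof. exact: scaler0. Qed.

Lemma addN_map X Y (f : hom X Y) : add_map (opp_map f) f = zero_map X Y.
Proof. exact: addNr. Qed.

Lemma opp_map0 X Y : opp_map (zero_map X Y) = zero_map X Y.
Proof. exact: oppr0. Qed.

Lemma opp_mapK X Y : involutive (@opp_map X Y).
Proof. exact: opprK. Qed.

Lemma subm0_eq X Y (f g : hom X Y) :
  add_map (opp_map g) f = zero_map X Y -> f = g.
Proof.
by rewrite /add_map /opp_map addrC => /(@eqP (lhom C X Y));
  rewrite subr_eq0 => /(@eqP (lhom C X Y)).
Qed.

Lemma comp0m X Y Z (f : hom X Y) : zero_map Y Z \oc f = zero_map X Z.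
Proof.
have := compPl (-1) (zero_map Y Z) (zero_map Y Z) f.
by rewrite scale_map0 add_map0 scaleN1_map addN_map.
Qed.

Lemma compm0 X Y Z (g : hom Y Z) : g \oc zero_map X Y = zero_map X Z.
Proof.
have := compPr (-1) g (zero_map X Y) (zero_map X Y).
by rewrite scale_map0 add_map0 scaleN1_map addN_map.
Qed.

Lemma comp_oppl X Y Z (g : hom Y Z) (f : hom X Y) :
  opp_map g \oc f = opp_map (g \oc f).
Proof.
have := compPl (-1) g (zero_map Y Z) f.
by rewrite comp0m !add_map0 !scaleN1_map.
Qed.

Lemma comp_oppr X Y Z (g : hom Y Z) (f : hom X Y) :
  g \oc opp_map f = opp_map (g \oc f).
Proof.
have := compPr (-1) g f (zero_map X Y).
by rewrite compm0 !add_map0 !scaleN1_map.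
Qed.

Lemma comp_subl X Y Z (g g' : hom Y Z) (f : hom X Y) :
  add_map (opp_map g') g \oc f = add_map (opp_map (g' \oc f)) (g \oc f).
Proof. by rewrite -!scaleN1_map compPl. Qed.

Lemma comp_subr X Y Z (g : hom Y Z) (f f' : hom X Y) :
  g \oc add_map (opp_map f') f = add_map (opp_map (g \oc f')) (g \oc f).
Proof. by rewrite -!scaleN1_map compPr. Qed.

Lemma linear_endo0 (F : functor C C) X Y :
  linear_endo F -> fmap F (zero_map X Y) = zero_map (F X) (F Y).
Proof.
move=> /(_ X Y (-1) (zero_map X Y) (zero_map X Y)).
by rewrite scale_map0 add_map0 scaleN1_map addN_map.
Qed.

Definition presheaf := functor (op_cat C) (Mod R).
Implicit Types H : presheaf.

Definition pobj H X : lmodType R := H X.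

Definition pmap H X Y (f : hom X Y) : {linear pobj H Y -> pobj H X} :=
  @fmap _ _ H Y X f.

Definition linear_presheaf H :=
  forall X Y (a : R) (f g : hom X Y) (x : pobj H Y),
    pmap H (add_map (scale_map a f) g) x = a *: pmap H f x + pmap H g x.

Lemma pmap1 H X (x : pobj H X) : pmap H (idm X) x = x.
Proof. by rewrite /pmap (@fmap1 _ _ H X). Qed.

Lemma pmapM H X Y Z (g : hom Y Z) (f : hom X Y) (x : pobj H Z) :
  pmap H (g \oc f) x = pmap H f (pmap H g x).
Proof. by rewrite /pmap (@fmapM _ _ H Z Y X f g). Qed.

Definition precomp M X Y (f : hom X Y) (g : lhom C Y M) : lhom C X M :=
  (g : hom Y M) \oc f.

Lemma precomp_is_linear M X Y (f : hom X Y) : linear (@precomp M X Y f).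
Proof. by move=> a g g'; apply: compPl. Qed.

HB.instance Definition _ M X Y (f : hom X Y) :=
  GRing.isLinear.Build R (lhom C Y M) (lhom C X M) _ (@precomp M X Y f)
    (@precomp_is_linear M X Y f).

Definition precomp_lin M X Y (f : hom X Y) :
  {linear lhom C Y M -> lhom C X M} := @precomp M X Y f.

Lemma precomp_lin1 M X : @precomp_lin M X X (idm X) = @idm (Mod R) (lhom C X M).
Proof. by apply: linearP_ext => g; exact: (@compm1 C X M g). Qed.

Lemma precomp_linM M X Y Z (g : hom Y Z) (f : hom X Y) :
  @precomp_lin M X Z (g \oc f) =
  @comp (Mod R) _ _ _ (precomp_lin M f) (precomp_lin M g).
Proof. by apply: linearP_ext => k; exact: (@compA C _ _ _ _ k g f). Qed.

Definition yoneda M : presheaf :=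
  @Functor (op_cat C) (Mod R) (fun X => lhom C X M)
    (fun X Y f => @precomp_lin M Y X f) (fun X => precomp_lin1 M X)
    (fun X Y Z g f => precomp_linM M f g).

Definition representable H := exists N, nat_isomorphic H (yoneda N).

End LinearCategory.

(* R-linear functors from the opposite of A to finitely presented R-modules. *)
Definition FunR (R : comPzRingType) (A : lincat R) : category :=
  @full_cat (functor_cat (op_cat A) (fpMod R))
    (fun F => @linear_presheaf R A (fcomp (@incl (Mod R) (@finitely_presented R)) F)).

(* The shift is an autoequivalence with a chosen quasi-inverse; the axioms are
   Verdier's TR1-TR4. [dist f g h] says that X -f-> Y -g-> Z -h-> X[1] is
   distinguished. *)
Record tricat (R : comPzRingType) := TriCat {
  tc_lin :> lincat R;
  tc_zero : exists Z : tc_lin, is_zero Z;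
  tc_biproduct : forall X Y : tc_lin, exists S, is_biproduct X Y S;
  shift : functor tc_lin tc_lin;
  unshift : functor tc_lin tc_lin;
  shiftK : quasi_inverse shift unshift;
  shift_linear : linear_endo shift;
  dist : forall X Y Z : tc_lin,
    hom X Y -> hom Y Z -> hom Z (shift X) -> Prop;
  dist_iso : forall (X Y Z X' Y' Z' : tc_lin)
    (f : hom X Y) (g : hom Y Z) (h : hom Z (shift X))
    (f' : hom X' Y') (g' : hom Y' Z') (h' : hom Z' (shift X'))
    (u : hom X X') (v : hom Y Y') (w : hom Z Z'),
    is_iso u -> is_iso v -> is_iso w ->
    v \oc f = f' \oc u -> w \oc g = g' \oc v -> fmap shift u \oc h = h' \oc w ->
    dist f g h -> dist f' g' h';
  dist_id : forall X Z : tc_lin, is_zero Z ->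
    dist (idm X) (zero_map X Z) (zero_map Z (shift X));
  dist_cone : forall (X Y : tc_lin) (f : hom X Y),
    exists Z (g : hom Y Z) (h : hom Z (shift X)), dist f g h;
  dist_rot : forall (X Y Z : tc_lin)
    (f : hom X Y) (g : hom Y Z) (h : hom Z (shift X)),
    dist f g h <-> dist g h (opp_map (fmap shift f));
  dist_mor : forall (X Y Z X' Y' Z' : tc_lin)
    (f : hom X Y) (g : hom Y Z) (h : hom Z (shift X))
    (f' : hom X' Y') (g' : hom Y' Z') (h' : hom Z' (shift X'))
    (u : hom X X') (v : hom Y Y'),
    dist f g h -> dist f' g' h' -> v \oc f = f' \oc u ->
    exists w : hom Z Z', w \oc g = g' \oc v /\ fmap shift u \oc h = h' \oc w;
  dist_oct : forall (X Y Z Q1 Q2 Q3 : tc_lin) (f : hom X Y) (g : hom Y Z)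
    (p1 : hom Y Q1) (d1 : hom Q1 (shift X))
    (p2 : hom Z Q2) (d2 : hom Q2 (shift X))
    (p3 : hom Z Q3) (d3 : hom Q3 (shift Y)),
    dist f p1 d1 -> dist (g \oc f) p2 d2 -> dist g p3 d3 ->
    exists (a : hom Q1 Q2) (b : hom Q2 Q3),
      [/\ dist a b (fmap shift p1 \oc d3),
          a \oc p1 = p2 \oc g, d2 \oc a = d1,
          b \oc p2 = p3 & d3 \oc b = fmap shift f \oc d2] }.

Section Shifts.
Variables (R : comPzRingType) (C : tricat R).
Implicit Types (X Y Z : C) (A B : C -> Prop) (i j m n : int).

Definition shiftz i X : C :=
  match i with
  | Posz n => iter n (shift C) X
  | Negz n => iter n.+1 (unshift C) X
  end.

(* The class A[i]; it is closed under isomorphism because [1] is only assumed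
   to be an equivalence. *)
Definition shifted A i X : Prop := exists Y, A Y /\ isomorphic X (shiftz i Y).

Lemma shift_full X Y (k : hom (shift C X) (shift C Y)) :
  exists f : hom X Y, fmap (shift C) f = k.
Proof. exact: quasi_inverse_full (shiftK C). Qed.

Lemma shift_faithful X Y (f g : hom X Y) :
  fmap (shift C) f = fmap (shift C) g -> f = g.
Proof. exact: quasi_inverse_faithful (shiftK C). Qed.

Lemma unshift_full X Y (k : hom (unshift C X) (unshift C Y)) :
  exists f : hom X Y, fmap (unshift C) f = k.
Proof. exact: quasi_inverse_full (quasi_inverse_sym (shiftK C)). Qed.

Lemma shift0 X Y : fmap (shift C) (zero_map X Y) = zero_map _ _.
Proof. exact: linear_endo0 (@shift_linear _ C). Qed.

Lemma unshift_shift X : isomorphic (unshift C (shift C X)) X.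
Proof. by have [[a /(_ X) isoa] _] := shiftK C; exists (a X). Qed.

Lemma shift_unshift X : isomorphic (shift C (unshift C X)) X.
Proof. by have [_ [a /(_ X) isoa]] := shiftK C; exists (a X). Qed.

Definition no_maps X Y := forall f : hom X Y, f = zero_map X Y.

Lemma no_maps_iso X Y X' Y' :
  isomorphic X' X -> isomorphic Y' Y -> no_maps X Y -> no_maps X' Y'.
Proof.
move=> [u [u' [u'u uu']]] [v [v' [v'v vv']]] XY f.
rewrite -[f]comp1m -v'v -[f in LHS]compm1 -u'u.
have -> : v' \oc v \oc (f \oc (u' \oc u)) = v' \oc (v \oc f \oc u') \oc u.
  by rewrite !compA.
by rewrite (XY (v \oc f \oc u')) compm0 comp0m.
Qed.

Lemma no_maps_shift X Y : no_maps X Y -> no_maps (shift C X) (shift C Y).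
Proof.
by move=> XY k; have [f <-] := shift_full k; rewrite (XY f) shift0.
Qed.

Lemma no_maps_unshift X Y : no_maps X Y -> no_maps (unshift C X) (unshift C Y).
Proof.
move=> XY k; have [f <-] := unshift_full k; rewrite (XY f).
apply: shift_faithful; rewrite shift0.
apply: (@no_maps_iso X Y) => //; exact: shift_unshift.
Qed.

Lemma no_maps_shiftz X Y i : no_maps X Y -> no_maps (shiftz i X) (shiftz i Y).
Proof.
case: i => n XY /=; last first.
  apply: no_maps_unshift; elim: n => //= n; exact: no_maps_unshift.
elim: n => //= n; exact: no_maps_shift.
Qed.

Lemma shiftz_iso X Y i : isomorphic X Y -> isomorphic (shiftz i X) (shiftz i Y).
Proof.
case: i => n XY /=; last apply: fmap_iso; elim: n => //= n; exact: fmap_iso.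
Qed.

Lemma shiftzS X i : isomorphic (shift C (shiftz i X)) (shiftz (i + 1) X).
Proof.
case: i => n; first by rewrite -PoszD addn1; apply: iso_refl.
have -> : Negz n + 1 = - n%:Z by rewrite NegzE -addn1 PoszD opprD addrNK.
by case: n => [|n]; rewrite -?NegzE; apply: shift_unshift.
Qed.

Lemma shiftzP X i : isomorphic (unshift C (shiftz i X)) (shiftz (i - 1) X).
Proof.
case: i => n; last first.
  have -> : Negz n - 1 = Negz n.+1.
    by rewrite !NegzE -opprD -[n.+2]addn1 PoszD.
  exact: iso_refl.
case: n => [|n]; first exact: iso_refl.
have -> : n.+1%:Z - 1 = n by rewrite -[n.+1]addn1 PoszD addrK.
exact: unshift_shift.
Qed.

Lemma shiftzD X i j : isomorphic (shiftz j (shiftz i X)) (shiftz (i + j) X).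
Proof.
case: j => n.
  elim: n => [|n IHn]; first by rewrite addr0; apply: iso_refl.
  have -> : i + n.+1%:Z = i + n%:Z + 1 by rewrite -[n.+1]addn1 PoszD addrA.
  exact: iso_trans (fmap_iso (shift C) IHn) (shiftzS _ _).
elim: n => [|n IHn]; first exact: shiftzP.
have -> : i + Negz n.+1 = i + Negz n - 1.
  by rewrite -addrA !NegzE -opprD -[n.+2]addn1 PoszD.
exact: iso_trans (fmap_iso (unshift C) IHn) (shiftzP _ _).
Qed.

Lemma dist_rotl X Y Z (f : hom X Y) (g : hom Y Z) (h : hom Z (shift C X)) :
  dist f g h -> dist g h (opp_map (fmap (shift C) f)).
Proof. by move/dist_rot. Qed.

Lemma dist_comp0 X Y Z (f : hom X Y) (g : hom Y Z) (h : hom Z (shift C X)) :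
  dist f g h -> g \oc f = zero_map X Z.
Proof.
move=> D; have [O zO] := tc_zero C.
have e : f \oc idm X = f \oc idm X by [].
have [w [<- _]] := dist_mor (dist_id X zO) D e; exact: compm0.
Qed.

Lemma dist_lift X Y Z (f : hom X Y) (g : hom Y Z) (h : hom Z (shift C X))
    W (k : hom W Y) :
  dist f g h -> g \oc k = zero_map W Z -> exists l, f \oc l = k.
Proof.
move=> D gk; have [O zO] := tc_zero C.
have e : zero_map O Z \oc zero_map W O = g \oc k by rewrite gk comp0m.
have [u [_]] := dist_mor (dist_rotl (dist_id W zO)) (dist_rotl D) e.
rewrite fmap1 comp_oppr comp_oppl compm1 => /(can_inj (@opp_mapK _ _ _ _)).
have [l <-] := shift_full u; rewrite -fmapM => /shift_faithful kE.
by exists l.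
Qed.

Lemma is_zero_shift O : is_zero O -> is_zero (shift C O).
Proof.
move=> zO; have e : idm (shift C O) = zero_map _ _.
  by rewrite -fmap1 ((zO O).1 (idm O)) shift0.
by move=> X; split=> f; [rewrite -[f]comp1m e comp0m | rewrite -[f]compm1 e compm0].
Qed.

Lemma dist_0id W O (zO : is_zero O) :
  dist (zero_map O W) (idm W) (zero_map W (shift C O)).
Proof.
apply/dist_rot; rewrite shift0 opp_map0.
exact: dist_id (is_zero_shift zO).
Qed.

Lemma dist_extend X Y Z (f : hom X Y) (g : hom Y Z) (h : hom Z (shift C X))
    W (k : hom Y W) :
  dist f g h -> k \oc f = zero_map X W -> exists l, l \oc g = k.
Proof.
move=> D kf; have [O zO] := tc_zero C.
have e : k \oc f = zero_map O W \oc zero_map X O by rewrite kf comp0m.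
have [l [lE _]] := dist_mor D (dist_0id W zO) e.
by exists l; rewrite lE comp1m.
Qed.

End Shifts.

Arguments shiftz {R C} i X.
Arguments shifted {R C} A i X.

Record weight_structure (R : comPzRingType) (C : tricat R) :=
    WeightStructure {
  w_le0 : C -> Prop;
  w_ge0 : C -> Prop;
  w_le0_retract : forall X Y : C, retract X Y -> w_le0 Y -> w_le0 X;
  w_ge0_retract : forall X Y : C, retract X Y -> w_ge0 Y -> w_ge0 X;
  w_le0_shift : forall X : C, w_le0 X -> shifted w_le0 1 X;
  w_ge0_shift : forall X : C, shifted w_ge0 1 X -> w_ge0 X;
  w_orth : orthogonal w_le0 (shifted w_ge0 1);
  w_dec : forall M : C, exists (L N : C)
    (f : hom L M) (g : hom M N) (h : hom N (shift C L)),
    [/\ dist f g h, w_le0 L & shifted w_ge0 1 N] }.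

Section Weights.
Variables (R : comPzRingType) (C : tricat R) (w : weight_structure C).
Implicit Types (X Y M N : C) (m n i : int).

Definition w_le i : C -> Prop := shifted (w_le0 w) i.
Definition w_ge i : C -> Prop := shifted (w_ge0 w) i.

Definition w_bounded :=
  (forall M, exists i, w_ge i M) /\ (forall M, exists i, w_le i M).

Definition w_heart : lincat R :=
  full_lincat (fun X => w_le0 w X /\ w_ge0 w X).

Record weight_dec (m : int) (M : C) := WeightDec {
  wd_le : C;
  wd_ge : C;
  wd_in : hom wd_le M;
  wd_out : hom M wd_ge;
  wd_bd : hom wd_ge (shift C wd_le);
  wd_dist : dist wd_in wd_out wd_bd;
  wd_leP : w_le m wd_le;
  wd_geP : w_ge (m + 1) wd_ge }.

Record dec_mor m n M N (f : hom M N) (d : weight_dec m M)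
    (e : weight_dec n N) := DecMor {
  dm_le : hom (wd_le d) (wd_le e);
  dm_ge : hom (wd_ge d) (wd_ge e);
  dm_in : f \oc wd_in d = wd_in e \oc dm_le;
  dm_out : dm_ge \oc wd_out d = wd_out e \oc f;
  dm_bd : fmap (shift C) dm_le \oc wd_bd d = wd_bd e \oc dm_ge }.

Lemma w_ge0_shiftn X (k : nat) : w_ge0 w X -> w_ge0 w (shiftz k X).
Proof.
move=> wX; elim: k => //= k IHk; apply: w_ge0_shift.
by exists (shiftz k X); split=> //; apply: iso_refl.
Qed.

Lemma w_no_maps m n X Y : m < n -> w_le m X -> w_ge n Y -> no_maps X Y.
Proof.
move=> lt_mn [A [wA XA]] [B [wB YB]].
have [k nE] : exists k : nat, n = k%:Z + 1 + m.
  exists (absz (n - m - 1)%R); rewrite gez0_abs; last by lia.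
  by lia.
have YB' : isomorphic Y (shiftz m (shiftz (k%:Z + 1) B)).
  by apply: (iso_trans YB); rewrite nE; apply/iso_sym/shiftzD.
apply: (no_maps_iso XA YB'); apply: no_maps_shiftz => f.
apply: (w_orth (w := w)) => //; exists (shiftz k B); split.
  exact: w_ge0_shiftn.
exact/iso_sym/shiftzD.
Qed.

Lemma w_le_shift m X : w_le m X -> w_le (m + 1) (shift C X).
Proof.
move=> [A [wA XA]]; exists A; split=> //.
exact: iso_trans (fmap_iso (shift C) XA) (shiftzS _ _).
Qed.

Lemma dec_mor_exists m n M N (f : hom M N) (d : weight_dec m M)
    (e : weight_dec n N) : m <= n -> exists _ : dec_mor f d e, True.
Proof.
move=> le_mn.
have z : wd_out e \oc (f \oc wd_in d) = zero_map _ _.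
  by apply: (w_no_maps _ (wd_leP d) (wd_geP e)); lia.
have [u uE] := dist_lift (wd_dist e) z.
have [v [vo vb]] := dist_mor (wd_dist d) (wd_dist e) (esym uE).
by exists (DecMor (esym uE) vo vb).
Qed.

Definition dec_morphism m n M N (f : hom M N) (d : weight_dec m M)
    (e : weight_dec n N) (le_mn : m <= n) : dec_mor f d e :=
  projT1 (cid (dec_mor_exists f d e le_mn)).

Lemma dec_le_uniq m n M N (d : weight_dec m M) (e : weight_dec n N)
    (a b : hom (wd_le d) (wd_le e)) :
  m < n -> wd_in e \oc a = wd_in e \oc b -> a = b.
Proof.
move=> lt_mn ab; apply: subm0_eq; set k := add_map _ _.
have ek : wd_in e \oc k = zero_map _ _ by rewrite comp_subr ab addN_map.
apply: shift_faithful; rewrite shift0.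
have D := dist_rotl (dist_rotl (wd_dist e)).
have [|l <-] := dist_lift (k := fmap (shift C) k) D.
  by rewrite comp_oppl -fmapM ek shift0 opp_map0.
rewrite (w_no_maps _ (w_le_shift (wd_leP d)) (wd_geP e) l) ?compm0 //; lia.
Qed.

Lemma dec_ge_uniq m n M N (d : weight_dec m M) (e : weight_dec n N)
    (a b : hom (wd_ge d) (wd_ge e)) :
  m < n -> a \oc wd_out d = b \oc wd_out d -> a = b.
Proof.
move=> lt_mn ab; apply: subm0_eq; set k := add_map _ _.
have ek : k \oc wd_out d = zero_map _ _ by rewrite comp_subl ab addN_map.
have [l <-] := dist_extend (dist_rotl (wd_dist d)) ek.
rewrite (w_no_maps _ (w_le_shift (wd_leP d)) (wd_geP e) l) ?comp0m //; lia.
Qed.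

End Weights.

(* A choice of weight decompositions of all objects; the functors tau_le and
   tau_ge do not depend on it up to isomorphism. *)
Definition weight_decs (R : comPzRingType) (C : tricat R)
    (w : weight_structure C) :=
  forall (m : int) (M : C), weight_dec w m M.

Lemma iso_idm (B : category) (X : B) : is_iso (idm X).
Proof. by exists (idm X); split; rewrite comp1m. Qed.

Lemma is_iso_inv (B : category) (X Y : B) (f : hom X Y) (g : hom Y X) :
  is_inverse f g -> is_iso f /\ is_iso g.
Proof. by move=> [gf fg]; split; [exists g | exists f]. Qed.

Section WeightDecompositions.
Variables (R : comPzRingType) (C : tricat R).
Implicit Types (X Y Z L M N : C) (m : int).

Lemma dist_shift X Y Z (f : hom X Y) (g : hom Y Z) (h : hom Z (shift C X)) :
  dist f g h <->
  dist (fmap (shift C) f) (fmap (shift C) g) (opp_map (fmap (shift C) h)).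
Proof.
have isoN : is_iso (opp_map (idm (shift C Y))).
  by apply: (is_iso_inv (g := opp_map (idm _)) _).1; split;
     rewrite comp_oppl comp_oppr opp_mapK comp1m.
rewrite dist_rot dist_rot dist_rot.
by split; apply: (dist_iso (u := idm _) (w := idm _) (iso_idm _) isoN (iso_idm _));
   rewrite ?fmap1 !(comp_oppl, comp_oppr, opp_mapK, comp1m, compm1).
Qed.

Lemma dist_transport X Y Z X' Y' Z'
    (f : hom X Y) (g : hom Y Z) (h : hom Z (shift C X)) :
  isomorphic X X' -> isomorphic Y Y' -> isomorphic Z Z' -> dist f g h ->
  exists (f' : hom X' Y') (g' : hom Y' Z') (h' : hom Z' (shift C X')),
    dist f' g' h'.
Proof.
move=> [u [u1 [u1u uu1]]] [v [v1 [v1v vv1]]] [w [w1 [w1w ww1]]] D.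
exists (v \oc f \oc u1), (w \oc g \oc v1), (fmap (shift C) u \oc h \oc w1).
apply: (dist_iso (u := u) (v := v) (w := w)) D; try by eexists; split; eauto.
- by rewrite -!compA u1u compm1.
- by rewrite -!compA v1v compm1.
- by rewrite -!compA w1w compm1.
Qed.

Variable w : weight_structure C.

Lemma shifted_isoz (A : C -> Prop) m X Y :
  isomorphic X Y -> shifted A m Y -> shifted A m X.
Proof. by move=> XY [B [AB YB]]; exists B; split=> //; apply: iso_trans YB. Qed.

Lemma shifted_shift (A : C -> Prop) m X :
  shifted A m X -> shifted A (m + 1) (shift C X).
Proof.
move=> [B [AB XB]]; exists B; split=> //.
exact: iso_trans (fmap_iso (shift C) XB) (shiftzS _ _).
Qed.

Lemma shifted_unshift (A : C -> Prop) m X :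
  shifted A m X -> shifted A (m - 1) (unshift C X).
Proof.
move=> [B [AB XB]]; exists B; split=> //.
exact: iso_trans (fmap_iso (unshift C) XB) (shiftzP _ _).
Qed.

Definition has_dec m M := exists (L N : C)
  (f : hom L M) (g : hom M N) (h : hom N (shift C L)),
  [/\ dist f g h, w_le w m L & w_ge w (m + 1) N].

Lemma has_decS m : (forall M, has_dec m M) -> forall M, has_dec (m + 1) M.
Proof.
move=> dec M; have [L [N [f [g [h [D leL geN]]]]]] := dec (unshift C M).
have [] := dist_transport (iso_refl _) (shift_unshift M) (iso_refl _)
  ((dist_shift _ _ _).1 D).
move=> f' [g' [h' D']]; exists (shift C L), (shift C N), f', g', h'; split=> //.
  exact: shifted_shift.
exact: shifted_shift.
Qed.

Lemma has_decP m : (forall M, has_dec m M) -> forall M, has_dec (m - 1) M.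
Proof.
move=> dec M; have [L [N [f [g [h [D leL geN]]]]]] := dec (shift C M).
have [] := dist_transport (iso_sym (shift_unshift L)) (iso_refl _)
  (iso_sym (shift_unshift N)) D.
move=> f' [g' [h' D']].
have [f0 f0E] := shift_full f'; have [g0 g0E] := shift_full g'.
have [h0 h0E] := shift_full (opp_map h').
exists (unshift C L), (unshift C N), f0, g0, h0; split.
- by apply/dist_shift; rewrite f0E g0E h0E opp_mapK.
- exact: shifted_unshift.
- have -> : m - 1 + 1 = m + 1 - 1 by lia.
  exact: shifted_unshift.
Qed.

Lemma has_dec_all m M : has_dec m M.
Proof.
move: M; case: m => n.
  elim: n => [|n IHn].
    move=> M; have [L [N [f [g [h [D leL geN]]]]]] := w_dec w M.
    exists L, N, f, g, h; split=> //.
    by exists L; split=> //; apply: iso_refl.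
  by rewrite -[n.+1]addn1 PoszD; apply: has_decS.
elim: n => [|n IHn].
  have -> : Negz 0 = 0 - 1 by [].
  apply: has_decP => M; have [L [N [f [g [h [D leL geN]]]]]] := w_dec w M.
  exists L, N, f, g, h; split=> //.
  by exists L; split=> //; apply: iso_refl.
have -> : Negz n.+1 = Negz n - 1 by rewrite !NegzE -opprD -[n.+2]addn1 PoszD.
exact: has_decP.
Qed.

Lemma weight_decs_exist : inhabited (weight_decs w).
Proof.
suff dec m M : inhabited (weight_dec w m M).
  by constructor=> m M; apply: projT1 (cid (_ : exists _ : weight_dec w m M, True));
     have [d] := dec m M; exists d.
have [L [N [f [g [h [D leL geN]]]]]] := has_dec_all m M.
by constructor; exists L N f g h.
Qed.

End WeightDecompositions.

Section ImageFunctor.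
Variables (R : comPzRingType) (C : lincat R) (H : presheaf C).
Variables (P Q : C -> C) (c : forall X, hom (P X) (Q X)).
Variables (p : forall X Y, hom X Y -> hom (P X) (P Y)).
Variables (q : forall X Y, hom X Y -> hom (Q X) (Q Y)).
Hypothesis cp : forall X Y (f : hom X Y), c Y \oc p f = q f \oc c X.
Hypothesis cp1 : forall X, c X \oc p (idm X) = c X.
Hypothesis cpM : forall X Y Z (g : hom Y Z) (f : hom X Y),
  c Z \oc p (g \oc f) = c Z \oc (p g \oc p f).

Lemma image_functor_subproof X Y (f : hom X Y) (x : pobj H (Q Y)) :
  exists x', pmap H (c X) x' = pmap H (p f) (pmap H (c Y) x).
Proof. by exists (pmap H (q f) x); rewrite -!pmapM cp. Qed.

Definition image_functor_map X Y (f : hom X Y) :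
    {linear image_mod (pmap H (c Y)) -> image_mod (pmap H (c X))} :=
  image_map (image_functor_subproof f).

Lemma image_functor1 X :
  image_functor_map (idm X) = @idm (Mod R) (image_mod (pmap H (c X))).
Proof.
apply: linearP_ext => y; apply: image_val_inj; rewrite image_mapE.
by have [x <-] := image_modP y; rewrite -pmapM cp1.
Qed.

Lemma image_functorM X Y Z (g : hom Y Z) (f : hom X Y) :
  image_functor_map (g \oc f) =
  @comp (Mod R) _ _ _ (image_functor_map f) (image_functor_map g).
Proof.
apply: linearP_ext => y; apply: image_val_inj; rewrite !image_mapE.
by have [x <-] := image_modP y; rewrite -!pmapM cpM.
Qed.

Definition image_functor : presheaf C :=
  @Functor (op_cat C) (Mod R) (fun X => image_mod (pmap H (c X)))
    (fun X Y f => image_functor_map f) image_functor1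
    (fun X Y Z g f => image_functorM f g).

End ImageFunctor.

Section Truncations.
Variables (R : comPzRingType) (C : tricat R) (w : weight_structure C).
Variables (D : weight_decs w) (H : presheaf C).
Implicit Types (X Y : C) (m n : int).

Lemma le_succ m : m <= m + 1. Proof. by lia. Qed.
Lemma lt_succ m : m < m + 1. Proof. by lia. Qed.

(* The connecting morphisms, in both components; they are unique by dec_le_uniq
   and dec_ge_uniq. *)
Definition dec_conn m X : dec_mor (idm X) (D m X) (D (m + 1) X) :=
  dec_morphism (idm X) (D m X) (D (m + 1) X) (le_succ m).

Definition dec_map m X Y (f : hom X Y) : dec_mor f (D m X) (D m Y) :=
  dec_morphism f (D m X) (D m Y) (lexx m).

Lemma conn_le_eq m X Y (a b : hom (wd_le (D m X)) (wd_le (D m Y))) :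
  wd_in (D m Y) \oc a = wd_in (D m Y) \oc b ->
  dm_le (dec_conn m Y) \oc a = dm_le (dec_conn m Y) \oc b.
Proof.
move=> ab; apply: (dec_le_uniq (lt_succ m)).
by rewrite !compA -!dm_in !comp1m.
Qed.

Lemma conn_ge_eq m X Y (a b : hom (wd_ge (D m X)) (wd_ge (D m Y))) :
  a \oc wd_out (D m X) = b \oc wd_out (D m X) ->
  dm_ge (dec_conn m Y) \oc a = dm_ge (dec_conn m Y) \oc b.
Proof.
by move=> ab; apply: (dec_ge_uniq (lt_succ m)); rewrite -!compA ab.
Qed.

Lemma conn_le_nat m X Y (f : hom X Y) :
  dm_le (dec_conn m Y) \oc dm_le (dec_map m f) =
  dm_le (dec_map (m + 1) f) \oc dm_le (dec_conn m X).
Proof.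
apply: (dec_le_uniq (lt_succ m)).
by rewrite !compA -!dm_in comp1m -compA -dm_in compA -compA -dm_in comp1m.
Qed.

Lemma conn_ge_nat m X Y (f : hom X Y) :
  dm_ge (dec_conn m Y) \oc dm_ge (dec_map m f) =
  dm_ge (dec_map (m + 1) f) \oc dm_ge (dec_conn m X).
Proof.
apply: (dec_ge_uniq (lt_succ m)).
by rewrite -!compA !dm_out compm1 compA dm_out compm1 dm_out.
Qed.

Lemma conn_le1 m X :
  dm_le (dec_conn m X) \oc dm_le (dec_map m (idm X)) = dm_le (dec_conn m X).
Proof.
rewrite -[RHS]compm1; apply: conn_le_eq.
by rewrite -dm_in comp1m compm1.
Qed.

Lemma conn_ge1 m X :
  dm_ge (dec_conn m X) \oc dm_ge (dec_map m (idm X)) = dm_ge (dec_conn m X).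
Proof.
rewrite -[RHS]compm1; apply: conn_ge_eq.
by rewrite dm_out comp1m compm1.
Qed.

Lemma conn_leM m X Y Z (g : hom Y Z) (f : hom X Y) :
  dm_le (dec_conn m Z) \oc dm_le (dec_map m (g \oc f)) =
  dm_le (dec_conn m Z) \oc (dm_le (dec_map m g) \oc dm_le (dec_map m f)).
Proof. by apply: conn_le_eq; rewrite -dm_in compA -dm_in -!compA (dm_in (dec_map m f)). Qed.

Lemma conn_geM m X Y Z (g : hom Y Z) (f : hom X Y) :
  dm_ge (dec_conn m Z) \oc dm_ge (dec_map m (g \oc f)) =
  dm_ge (dec_conn m Z) \oc (dm_ge (dec_map m g) \oc dm_ge (dec_map m f)).
Proof. by apply: conn_ge_eq; rewrite -compA !dm_out !compA dm_out. Qed.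

(* tau_{<= n}(H)(X) = Im(H(w_{<= n+1} X) -> H(w_{<= n} X)). *)
Definition tau_le n : presheaf C :=
  image_functor H (conn_le_nat n) (conn_le1 n) (conn_leM n).

(* tau_{>= n}(H)(X) = Im(H(w_{>= n} X) -> H(w_{>= n-1} X)), where the complement
   w_{>= n} X belongs to the (n-1)-weight decomposition of X. *)
Definition tau_ge n : presheaf C :=
  image_functor H (conn_ge_nat (n - 2)) (conn_ge1 (n - 2)) (conn_geM (n - 2)).

End Truncations.

Record t_structure (R : comPzRingType) (C : tricat R) := TStructure {
  t_le0 : C -> Prop;
  t_ge0 : C -> Prop;
  t_le0_iso : forall X Y : C, isomorphic X Y -> t_le0 X -> t_le0 Y;
  t_ge0_iso : forall X Y : C, isomorphic X Y -> t_ge0 X -> t_ge0 Y;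
  t_le0_shift : forall X : C, t_le0 X -> shifted t_le0 1 X;
  t_ge0_shift : forall X : C, shifted t_ge0 1 X -> t_ge0 X;
  t_orth : orthogonal (shifted t_ge0 1) t_le0;
  t_dec : forall M : C, exists (L N : C)
    (f : hom L M) (g : hom M N) (h : hom N (shift C L)),
    [/\ dist f g h, t_ge0 L & shifted t_le0 (-1) N] }.

Definition t_bounded (R : comPzRingType) (C : tricat R) (t : t_structure C) :=
  (forall M, exists i : int, shifted (t_ge0 t) i M) /\
  (forall M, exists i : int, shifted (t_le0 t) i M).

Definition t_heart (R : comPzRingType) (C : tricat R) (t : t_structure C) :
    lincat R :=
  full_lincat (fun X => t_le0 t X /\ t_ge0 t X).

Definition right_adjacent (R : comPzRingType) (C : tricat R)
    (t : t_structure C) (w : weight_structure C) :=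
  forall M : C, t_ge0 t M <-> w_ge0 w M.

Section Saturation.
Variables (R : comPzRingType) (C : tricat R).
Implicit Types (H : presheaf C) (X Y Z M G : C).

Definition cohomological H :=
  forall X Y Z (f : hom X Y) (g : hom Y Z) (h : hom Z (shift C X)),
    dist f g h ->
    forall y : pobj H Y, pmap H f y = 0 <-> exists z, pmap H g z = y.

Record finite_functor H : Prop := FiniteFunctor {
  ff_linear : linear_presheaf H;
  ff_cohomological : cohomological H;
  ff_fp : forall M, finitely_presented (pobj H M);
  ff_vanish : forall M, exists a b : int, forall i : int,
    i < a \/ b < i -> forall x : pobj H (shiftz (- i) M), x = 0 }.

Definition saturated := forall H, representable H <-> finite_functor H.

(* P is the class of objects of a full triangulated subcategory closed under
   retracts. *)
Record dense_subcategory (P : C -> Prop) : Prop := DenseSubcategory {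
  ds_zero : forall Z, is_zero Z -> P Z;
  ds_shift : forall X, P X -> P (shift C X);
  ds_unshift : forall X, P X -> P (unshift C X);
  ds_cone : forall X Y Z (f : hom X Y) (g : hom Y Z) (h : hom Z (shift C X)),
    dist f g h -> P X -> P Y -> P Z;
  ds_retract : forall X Y, retract X Y -> P Y -> P X }.

Definition densely_generated G :=
  forall P, dense_subcategory P -> P G -> forall M, P M.

Lemma representable_yoneda M : representable (yoneda M).
Proof.
exists M, (nat_id (yoneda M)) => X.
by exists (idm (yoneda M X)); split; rewrite comp1m.
Qed.

Lemma saturated_fp (satC : saturated) X M : finitely_presented (lhom C X M).
Proof. exact: (ff_fp ((satC _).1 (representable_yoneda M)) X). Qed.

Variables (satC : saturated) (w : weight_structure C) (t : t_structure C).

Definition ry_obj_functor (M : t_heart t) :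
    functor (op_cat (w_heart w)) (fpMod R) :=
  @Functor (op_cat (w_heart w)) (fpMod R)
    (fun A => exist _ (lhom C (sval A) (sval M)) (saturated_fp satC _ _))
    (fun A B f => precomp_lin (sval M) (f : @hom C (sval B) (sval A)))
    (fun A => precomp_lin1 (sval M) (sval A))
    (fun A B E g f => precomp_linM (sval M) f g).

Lemma ry_obj_linear (M : t_heart t) :
  @linear_presheaf R (w_heart w)
    (fcomp (@incl (Mod R) (@finitely_presented R)) (ry_obj_functor M)).
Proof. move=> A B a f g x; exact: (@compPr R C _ _ _ a x f g). Qed.

Definition ry_obj (M : t_heart t) : FunR (w_heart w) :=
  exist _ (ry_obj_functor M) (@ry_obj_linear M).

Definition postcomp X M N (g : hom M N) (f : lhom C X M) : lhom C X N :=
  g \oc (f : hom X M).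

Lemma postcomp_is_linear X M N (g : hom M N) : linear (@postcomp X M N g).
Proof. by move=> a f f'; apply: compPr. Qed.

HB.instance Definition _ X M N (g : hom M N) :=
  GRing.isLinear.Build R (lhom C X M) (lhom C X N) _ (@postcomp X M N g)
    (@postcomp_is_linear X M N g).

Definition postcomp_lin X M N (g : hom M N) :
  {linear lhom C X M -> lhom C X N} := @postcomp X M N g.

Lemma ry_map_nat (M N : t_heart t) (g : hom M N) (A B : op_cat (w_heart w))
    (f : hom A B) :
  @comp (fpMod R) (ry_obj_functor M A) (ry_obj_functor M B)
    (ry_obj_functor N B) (postcomp_lin (sval B) (g : @hom C (sval M) (sval N)))
    (fmap (ry_obj_functor M) f) =
  @comp (fpMod R) (ry_obj_functor M A) (ry_obj_functor N A)
    (ry_obj_functor N B) (fmap (ry_obj_functor N) f)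
    (postcomp_lin (sval A) (g : @hom C (sval M) (sval N))).
Proof.
by apply: linearP_ext => x; exact: (@compA C _ _ _ _ g x f).
Qed.

Definition ry_map (M N : t_heart t) (g : hom M N) :
    @hom (FunR (w_heart w)) (ry_obj M) (ry_obj N) :=
  @NatTrans (op_cat (w_heart w)) (fpMod R) (ry_obj_functor M)
    (ry_obj_functor N)
    (fun A => postcomp_lin (sval A) (g : @hom C (sval M) (sval N)))
    (ry_map_nat g).

Lemma ry_map1 (M : t_heart t) : ry_map (idm M) = idm (ry_obj M).
Proof.
apply: nat_transP => A; apply: linearP_ext => x.
exact: (@comp1m C _ _ x).
Qed.

Lemma ry_mapM (M N K : t_heart t) (g : hom N K) (f : hom M N) :
  ry_map (g \oc f) = ry_map g \oc ry_map f.
Proof.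
apply: nat_transP => A; apply: linearP_ext => x.
exact: (esym (@compA C _ _ _ _ g f x)).
Qed.

(* M |-> C(-, M), restricted to the heart of w; its values are finitely
   presented since representable functors on a saturated category are finite. *)
Definition restricted_yoneda : functor (t_heart t) (FunR (w_heart w)) :=
  @Functor (t_heart t) (FunR (w_heart w)) ry_obj ry_map ry_map1 ry_mapM.

End Saturation.

(* Main.v *)
(* Virtual t-truncations are cohomological because the cone of
   w_{<= n} X -> w_{<= n+1} Y is an (n+1)-weight truncation of the cone of
   X -> Y; over a coherent ring the truncations of C(-, M) are then finite, hence
   representable.  The object representing tau_{>= 0} C(-, M) is the t-truncation
   of M.  If G generates C then t is bounded: for k large, t_{>= k} M receives no
   maps from any shift of G, because G is an iterated extension of shifts of
   objects of Hw, and so it vanishes.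

   C(-, M) restricted to Hw determines M in Ht, since M has a presentation by
   objects of Hw with remainder in w_{>= 1}.  Conversely F : Hw^op -> R-mod
   extends to C by sending X to Z(X) / B(X): cover w_{>= 0} X by A in Hw; then
   Z(X) consists of the s in F(A) with F(a) s = 0 for all a : A' -> A that become
   zero in w_{>= 0} X, and B(X) of the restrictions of the elements of F(B) along
   A -> w_{>= 0} X -> (w_{<= -1} X)[1] -> B = w_{>= 0} ((w_{<= -1} X)[1]).
   This extension is a finite functor, and the object representing it lies in Ht. *)

From HB Require Import structures.
From mathcomp Require Import all_boot all_order all_algebra.
From mathcomp Require Import boolp zify.
Require Import Defs.

Set Implicit Arguments.
Unset Strict Implicit.
Unset Printing Implicit Defensive.

Import Order.TTheory GRing.Theory Num.Theory.
Local Open Scope ring_scope.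
Local Open Scope cat_scope.

(** * Finitely presented modules over a coherent ring *)

Section FreeModules.
Variable R : comPzRingType.
Implicit Types U V W : lmodType R.

Definition row_comb V n (v : 'I_n -> V) (x : 'rV[R]_n) : V :=
  \sum_(i < n) x 0 i *: v i.

Lemma row_comb_is_linear V n (v : 'I_n -> V) : linear (row_comb v).
Proof.
move=> a x y; rewrite /row_comb scaler_sumr -big_split /=.
by apply: eq_bigr => i _; rewrite !mxE scalerDl scalerA.
Qed.

HB.instance Definition _ V n (v : 'I_n -> V) :=
  GRing.isLinear.Build R 'rV[R]_n V _ (row_comb v) (row_comb_is_linear v).

Lemma linear_row_comb V n (f : {linear 'rV[R]_n -> V}) (x : 'rV[R]_n) :
  f x = row_comb (fun i => f (delta_mx 0 i)) x.
Proof.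
rewrite {1}(row_sum_delta x) linear_sum; apply: eq_bigr => i _.
by rewrite linearZ.
Qed.

(** Projectivity of free modules: preimages are chosen for the basis rows and extended linearly.
    Only the values of [g] have to be hit by [e]. *)
Lemma free_lift U V n (e : {linear U -> V}) (g : {linear 'rV[R]_n -> V}) :
  (forall x, exists u, e u = g x) ->
  exists f : {linear 'rV[R]_n -> U}, forall x, e (f x) = g x.
Proof.
move=> lift; have [v vE] := choice (fun i => lift (delta_mx 0 i)).
exists (row_comb v) => x; rewrite (linear_row_comb g) linear_sum.
by apply: eq_bigr => i _; rewrite linearZ vE.
Qed.

(** Submodules appear as predicates, so kernels and their images need no module type of their
    own. *)
Definition fin_gen V (P : V -> Prop) :=
  exists n (d : {linear 'rV[R]_n -> V}), forall y, P y <-> exists z, d z = y.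

Lemma fin_gen_image U V (P : U -> Prop) (Q : V -> Prop) (f : {linear U -> V}) :
  fin_gen P -> (forall y, Q y <-> exists2 x, P x & f x = y) -> fin_gen Q.
Proof.
move=> [n [d dP]] QE; exists n, (lin_comp f d) => y.
split=> [/QE[x /dP[z <-] <-]|[z <-]]; first by exists z.
by apply/QE; exists (d z) => //; apply/dP; exists z.
Qed.

Definition pair_map V m n (f : {linear 'rV[R]_m -> V})
    (g : {linear 'rV[R]_n -> V}) (x : 'rV[R]_(m + n)) : V :=
  f (lsubmx x) + g (rsubmx x).

Lemma pair_map_is_linear V m n (f : {linear 'rV[R]_m -> V})
  (g : {linear 'rV[R]_n -> V}) : linear (pair_map f g).
Proof.
by move=> a x y; rewrite /pair_map !linearP /= scalerDr addrACA.
Qed.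

HB.instance Definition _ V m n (f : {linear 'rV[R]_m -> V})
    (g : {linear 'rV[R]_n -> V}) :=
  GRing.isLinear.Build R 'rV[R]_(m + n) V _ (pair_map f g)
    (pair_map_is_linear f g).

Lemma pair_map_row V m n (f : {linear 'rV[R]_m -> V})
    (g : {linear 'rV[R]_n -> V}) x y :
  pair_map f g (row_mx x y) = f x + g y.
Proof. by rewrite /pair_map row_mxKl row_mxKr. Qed.

Lemma fp_fin_gen V : finitely_presented V -> fin_gen (fun _ : V => True).
Proof. by move=> [m [n [d [e [se ke]]]]]; exists n, e. Qed.

(* Schanuel: finite generation of the relations does not depend on the chosen
   generators. *)
Lemma fp_relations V n (f : {linear 'rV[R]_n -> V}) :
  finitely_presented V -> (forall y, exists x, f x = y) ->
  fin_gen (fun x => f x = 0).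
Proof.
move=> [k [m [d [e [se ke]]]]] sf.
have [p pE] := free_lift (fun x => se (f x)).
have [q qE] := free_lift (fun x => sf (e x)).
(* Write x = (x - q (p x)) + q (p x): when f x = 0, p x is a relation of the given presentation, so
   the second summand lies in the image of q d. *)
exists (n + k)%N, (pair_map (GRing.add_fun idfun (GRing.opp_fun (lin_comp q p)))
  (lin_comp q d)) => x; split.
  move=> fx; have /ke[z dz] : e (p x) = 0 by rewrite pE.
  exists (row_mx x z); rewrite /= pair_map_row /= dz.
  by rewrite addrNK.
move=> [z <-]; rewrite /pair_map /= !linearD !linearN /= !qE pE subrr add0r.
by apply/ke; eexists.
Qed.

End FreeModules.
Section ImageModule.
Variables (R : comPzRingType) (U V : lmodType R) (f : {linear U -> V}).

Lemma image_val0 : image_val (0 : image_mod f) = 0.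
Proof. exact: (linear0 (val : image_mod f -> V)). Qed.

Lemma to_image_subproof x : f x \in in_image f.
Proof. by apply/asboolP; exists x. Qed.

Definition to_image (x : U) : image_mod f := ImageElt (to_image_subproof x).

Lemma to_image_is_linear : linear to_image.
Proof.
by move=> a x y; apply: image_val_inj; rewrite image_val_linear /= linearP.
Qed.

HB.instance Definition _ :=
  GRing.isLinear.Build R U (image_mod f) _ to_image to_image_is_linear.

Lemma to_image_surj (y : image_mod f) : exists x, to_image x = y.
Proof.
by have [x xE] := image_modP y; exists x; apply: image_val_inj.
Qed.

Lemma to_image_eq0 x : to_image x = 0 <-> f x = 0.
Proof.
split=> [/(congr1 (@image_val _ _ _ f))|e]; first by rewrite image_val0.
by apply: image_val_inj; rewrite image_val0.
Qed.

End ImageModule.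

(** * Kernels, images and quotients of finitely presented modules *)

Section Coherence.
Variable R : comPzRingType.
Hypothesis cohR : coherent R.
Implicit Types U V W : lmodType R.

(** Induction on the number of coordinates of the target. The first coordinate of [f] has as image a
    finitely generated ideal, so coherence and [fp_relations] give generators [q] of its kernel; the
    other coordinates, composed with [q], fall under the induction hypothesis. *)
Lemma coherent_ker m n (f : {linear 'rV[R]_m -> 'rV[R]_n}) :
  fin_gen (fun x => f x = 0).
Proof.
elim: n m f => [|n IHn] m f.
  exists m, idfun => x; split=> [_|[z /= <-]]; first by exists x.
  exact: thinmx0.
pose a i := f (delta_mx 0 i) 0 0.
have fa x : f x 0 0 = lin_comb a x.
  rewrite (linear_row_comb f) /row_comb summxE; apply: eq_bigr => i _.
  by rewrite mxE.
have [p [q qP]] := @fp_relations R (fg_ideal a) m (to_image (lin_comb a))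
  (cohR a) (@to_image_surj _ _ _ _).
pose r : {linear 'rV[R]_n.+1 -> 'rV[R]_n} := @col' R 1 n.+1 0.
apply: (fin_gen_image (f := q) (IHn p (lin_comp r (lin_comp f q)))) => x.
split=> [fx|[z /= rz <-]].
  have /qP[z zx] : to_image (lin_comb a) x = 0.
    by apply/to_image_eq0; rewrite /= -fa fx mxE.
  by exists z => //=; rewrite zx fx linear0.
have /to_image_eq0 : to_image (lin_comb a) (q z) = 0 by apply/qP; exists z.
rewrite /= -fa => e; apply/rowP => j; case: (unliftP 0 j) => [k|] -> //.
  by have /rowP/(_ k) := rz; rewrite !mxE.
by rewrite e mxE.
Qed.

(** Lift [f] to [p] through the generators [e]. Then f x = 0 exactly when p x lies in the image of
    [d], so the kernel is the projection of the kernel of (x, z) -> p x + d z, a map of free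
    modules. *)
Lemma fp_ker V n (f : {linear 'rV[R]_n -> V}) :
  finitely_presented V -> fin_gen (fun x => f x = 0).
Proof.
move=> [k [m [d [e [se ke]]]]].
have [p pE] := free_lift (fun x => se (f x)).
apply: (fin_gen_image
  (f := (@lsubmx R 1 n k : {linear 'rV[R]_(n + k) -> 'rV[R]_n}))
  (coherent_ker (pair_map p d))) => x.
split=> [fx|[z /= ez <-]].
  have /ke[z dz] : e (p x) = 0 by rewrite pE.
  by exists (row_mx x (- z)); rewrite /= ?row_mxKl // pair_map_row linearN dz subrr.
rewrite -pE; apply/ke; exists (- rsubmx z); apply/eqP.
by rewrite linearN eq_sym -addr_eq0; apply/eqP.
Qed.

Lemma fin_gen_ker U V (f : {linear U -> V}) :
  finitely_presented U -> finitely_presented V -> fin_gen (fun x => f x = 0).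
Proof.
move=> /fp_fin_gen[n [e eP]] fpV.
apply: (fin_gen_image (f := e) (fp_ker (lin_comp f e) fpV)) => x.
split=> [fx|[z fz <-] //]; have [z zx] := (eP x).1 I.
by exists z => //=; rewrite zx.
Qed.

Lemma fp_image U V (f : {linear U -> V}) :
  fin_gen (fun _ : U => True) -> finitely_presented V ->
  finitely_presented (image_mod f).
Proof.
move=> [n [e eP]] fpV; have [m [d dP]] := fp_ker (lin_comp f e) fpV.
exists m, n, d, (lin_comp (to_image f) e); split=> [y|x].
  have [x <-] := to_image_surj y.
  by have [z <-] := (eP x).1 I; exists z.
by rewrite -dP; apply: to_image_eq0.
Qed.

(** The relations between the images of the generators [e] are the x with e x in the image of [d]:
    again a projection of a kernel, now that of (x, z) -> e x + d (g z). *)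
Lemma fp_quotient U V W (d : {linear U -> V}) (p : {linear V -> W}) :
  fin_gen (fun _ : U => True) -> finitely_presented V ->
  (forall y, exists x, p x = y) -> (forall x, p x = 0 <-> exists z, d z = x) ->
  finitely_presented W.
Proof.
move=> [m [g gP]] fpV sp kp; have [n [e eP]] := fp_fin_gen fpV.
have [k [r rP]] : fin_gen (fun x => p (e x) = 0).
  apply: (fin_gen_image
    (f := (@lsubmx R 1 n m : {linear 'rV[R]_(n + m) -> 'rV[R]_n}))
    (fp_ker (pair_map e (lin_comp d g)) fpV)) => x.
  split=> [/kp[u du]|[z /= ez <-]].
    have [z zu] := (gP u).1 I.
    exists (row_mx x (- z)); rewrite /= ?row_mxKl // pair_map_row /=.
    by rewrite !linearN /= zu du subrr.
  apply/kp; exists (- g (rsubmx z)); apply/eqP.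
  by rewrite linearN eq_sym -addr_eq0; apply/eqP.
exists k, n, r, (lin_comp p e); split=> // y.
by have [x <-] := sp y; have [z <-] := (eP x).1 I; exists z.
Qed.

End Coherence.

(** * Cokernels *)

Section Cokernel.
Variables (R : comPzRingType) (U V : lmodType R) (d : {linear U -> V}).

Definition coset_eq (x y : V) : Prop := exists u, d u = x - y.

Lemma coset_eqxx x : coset_eq x x.
Proof. by exists 0; rewrite linear0 subrr. Qed.

Lemma coset_eq_sym x y : coset_eq x y -> coset_eq y x.
Proof. by move=> [u ux]; exists (- u); rewrite linearN ux opprB. Qed.

Lemma coset_eq_trans y x z : coset_eq x y -> coset_eq y z -> coset_eq x z.
Proof.
move=> [u ux] [v vy]; exists (u + v); rewrite linearD ux vy.
by rewrite addrA subrK.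
Qed.

Lemma coset_eqP a x x' y y' : coset_eq x x' -> coset_eq y y' ->
  coset_eq (a *: x + y) (a *: x' + y').
Proof.
move=> [u ux] [v vy]; exists (a *: u + v); rewrite linearP ux vy scalerBr.
by rewrite opprD addrACA.
Qed.

(** [choose] is fed the coset as a predicate, so its value depends on the coset alone; the cokernel
    is then the subtype of chosen representatives. *)
Definition coset_repr (x : V) : V := choose (fun y => `[< coset_eq x y >]) x.

Lemma coset_reprP x : coset_eq x (coset_repr x).
Proof.
have := @chooseP V (fun y => `[< coset_eq x y >]) x.
by move=> /(_ (asboolT (coset_eqxx x))) /asboolP.
Qed.

Lemma coset_repr_eq x y : coset_eq x y -> coset_repr x = coset_repr y.
Proof.
move=> xy; rewrite /coset_repr.
have -> : (fun z => `[< coset_eq x z >]) = (fun z => `[< coset_eq y z >]).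
  apply/funext => z; apply/asbool_equiv_eq; split.
    exact: coset_eq_trans (coset_eq_sym xy).
  exact: coset_eq_trans xy.
by apply: choose_id; apply: asboolT; [apply: coset_eq_sym | apply: coset_eqxx].
Qed.

Lemma coset_repr_id x : coset_repr (coset_repr x) = coset_repr x.
Proof. by apply/coset_repr_eq/coset_eq_sym/coset_reprP. Qed.

Record coker_type := CokerElt {
  coker_val : V; _ : coset_repr coker_val == coker_val }.

HB.instance Definition _ := [isSub for coker_val].
HB.instance Definition _ := [Choice of coker_type by <:].

Definition coker_proj_fun (x : V) : coker_type :=
  CokerElt (introT eqP (coset_repr_id x)).

Lemma coker_proj_eq x y : coset_eq x y -> coker_proj_fun x = coker_proj_fun y.
Proof. by move=> xy; apply: val_inj; apply: coset_repr_eq. Qed.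

Lemma coker_valK : cancel coker_val coker_proj_fun.
Proof. by move=> x; apply: val_inj; apply/eqP; case: x. Qed.

Lemma coker_projK x : coset_eq (coker_val (coker_proj_fun x)) x.
Proof. exact/coset_eq_sym/coset_reprP. Qed.

Definition coker_add (x y : coker_type) :=
  coker_proj_fun (coker_val x + coker_val y).
Definition coker_opp (x : coker_type) := coker_proj_fun (- coker_val x).
Definition coker_scale a (x : coker_type) := coker_proj_fun (a *: coker_val x).

Lemma coker_projD x y :
  coker_proj_fun (x + y) = coker_add (coker_proj_fun x) (coker_proj_fun y).
Proof.
apply/coker_proj_eq/coset_eq_sym.
by have := coset_eqP 1 (coker_projK x) (coker_projK y); rewrite !scale1r.
Qed.

Lemma coker_projZ a x :
  coker_proj_fun (a *: x) = coker_scale a (coker_proj_fun x).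
Proof.
apply/coker_proj_eq/coset_eq_sym.
by have := coset_eqP a (coker_projK x) (coset_eqxx 0); rewrite !addr0.
Qed.

Lemma coker_projN x : coker_proj_fun (- x) = coker_opp (coker_proj_fun x).
Proof. by rewrite -scaleN1r coker_projZ /coker_scale scaleN1r. Qed.

Lemma coker_addA : associative coker_add.
Proof.
move=> x y z; rewrite -[x]coker_valK -[y]coker_valK -[z]coker_valK.
by rewrite -!coker_projD addrA.
Qed.

Lemma coker_addC : commutative coker_add.
Proof. by move=> x y; rewrite /coker_add addrC. Qed.

Lemma coker_add0 : left_id (coker_proj_fun 0) coker_add.
Proof. by move=> x; rewrite -[x]coker_valK -coker_projD add0r. Qed.

Lemma coker_addN : left_inverse (coker_proj_fun 0) coker_opp coker_add.
Proof.
by move=> x; rewrite -[x]coker_valK -coker_projN -coker_projD addNr.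
Qed.

HB.instance Definition _ := GRing.isZmodule.Build coker_type
  coker_addA coker_addC coker_add0 coker_addN.

Lemma coker_scaleA a b x : coker_scale a (coker_scale b x) = coker_scale (a * b) x.
Proof. by rewrite -[x]coker_valK -!coker_projZ scalerA. Qed.

Lemma coker_scale1 : left_id 1 coker_scale.
Proof. by move=> x; rewrite -[x]coker_valK -coker_projZ scale1r. Qed.

Lemma coker_scaleDr : right_distributive coker_scale +%R.
Proof.
move=> a x y; rewrite -[x]coker_valK -[y]coker_valK.
rewrite -[LHS]/(coker_scale a (coker_add _ _)) -coker_projD -!coker_projZ.
by rewrite scalerDr coker_projD.
Qed.

Lemma coker_scaleDl x : {morph coker_scale^~ x : a b / a + b}.
Proof.
move=> a b; rewrite -[x]coker_valK -!coker_projZ.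
by rewrite scalerDl coker_projD.
Qed.

HB.instance Definition _ := GRing.Zmodule_isLmodule.Build R coker_type
  coker_scaleA coker_scale1 coker_scaleDr coker_scaleDl.

Definition coker_mod : lmodType R := coker_type.

Definition coker_proj (x : V) : coker_mod := coker_proj_fun x.

Lemma coker_proj_is_linear : linear coker_proj.
Proof.
by move=> a x y; rewrite /coker_proj coker_projD coker_projZ.
Qed.

HB.instance Definition _ :=
  GRing.isLinear.Build R V coker_mod _ coker_proj coker_proj_is_linear.

Lemma coker_proj_surj y : exists x, coker_proj x = y.
Proof. by exists (coker_val y); apply: coker_valK. Qed.

Lemma coker_proj_eq0 x : coker_proj x = 0 <-> exists u, d u = x.
Proof.
split=> [x0|[u ux]]; last first.
  by rewrite -(linear0 coker_proj); apply: coker_proj_eq; exists u; rewrite subr0.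
have /(coset_eq_trans (coset_reprP x)) : coset_eq (coset_repr x) 0.
  have -> : coset_repr x = coset_repr 0 by have /(congr1 coker_val) := x0.
  exact/coset_eq_sym/coset_reprP.
by move=> [u]; rewrite subr0; exists u.
Qed.

Variables (W : lmodType R) (g : {linear V -> W}).
Hypothesis gd : forall u, g (d u) = 0.

Definition coker_lift_fun (x : coker_mod) : W := g (coker_val x).

Lemma coker_lift_proj x : coker_lift_fun (coker_proj x) = g x.
Proof.
have [u ux] := coker_projK x; apply/eqP; rewrite -subr_eq0 -linearB /=.
by rewrite -ux gd.
Qed.

Lemma coker_lift_is_linear : linear coker_lift_fun.
Proof.
move=> a x y; have [x' <-] := coker_proj_surj x.
have [y' <-] := coker_proj_surj y.
by rewrite -linearP !coker_lift_proj linearP.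
Qed.

HB.instance Definition _ :=
  GRing.isLinear.Build R coker_mod W _ coker_lift_fun coker_lift_is_linear.

Definition coker_lift : {linear coker_mod -> W} := coker_lift_fun.

End Cokernel.

(** * Triangles and weight classes *)

Section Triangles.
Variables (R : comPzRingType) (C : tricat R).
Implicit Types (X Y Z L N W : C).

Lemma iso_retract X Y : isomorphic X Y -> retract X Y.
Proof. by move=> [f [g [gf _]]]; exists f, g. Qed.

Lemma fmap_retract (F : functor C C) X Y : retract X Y -> retract (F X) (F Y).
Proof.
by move=> [i [p pi]]; exists (fmap F i), (fmap F p); rewrite -fmapM pi fmap1.
Qed.

Lemma retract_shiftz (i : int) X Y :
  retract X Y -> retract (shiftz i X) (shiftz i Y).
Proof.
case: i => n XY /=; last apply: fmap_retract.
  by elim: n => //= n; apply: fmap_retract.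
by elim: n => //= n; apply: fmap_retract.
Qed.

Lemma shiftz_eq0 (i j : int) X :
  i + j = 0 -> isomorphic (shiftz j (shiftz i X)) X.
Proof. by move=> ij; have := shiftzD X i j; rewrite ij. Qed.

(** Moves the shift from the class to the object, so that closure properties of A pass to every
    A[i]. *)
Lemma shiftedE (A : C -> Prop) (i : int) X :
  (forall Y Z, isomorphic Y Z -> A Y -> A Z) ->
  shifted A i X <-> A (shiftz (- i) X).
Proof.
move=> Aiso; split=> [[Y [AY XY]]|AX].
  apply: Aiso AY; apply/iso_sym/(iso_trans (shiftz_iso (- i) XY)).
  by apply: shiftz_eq0; rewrite subrr.
exists (shiftz (- i) X); split=> //; apply/iso_sym/shiftz_eq0.
by rewrite addNr.
Qed.

Lemma dist_lift2 X Y Z (f : hom X Y) (g : hom Y Z) (h : hom Z (shift C X))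
    W (k : hom W Z) :
  dist f g h -> h \oc k = zero_map _ _ -> exists l, g \oc l = k.
Proof. by move=> D; apply: dist_lift (dist_rotl D). Qed.

Lemma dist_lift3 X Y Z (f : hom X Y) (g : hom Y Z) (h : hom Z (shift C X))
    W (k : hom W (shift C X)) :
  dist f g h -> fmap (shift C) f \oc k = zero_map _ _ -> exists l, h \oc l = k.
Proof.
move=> D fk; apply: dist_lift (dist_rotl (dist_rotl D)) _.
by rewrite comp_oppl fk opp_map0.
Qed.

Lemma dist_extend2 X Y Z (f : hom X Y) (g : hom Y Z) (h : hom Z (shift C X))
    W (k : hom Z W) :
  dist f g h -> k \oc g = zero_map _ _ -> exists l, l \oc h = k.
Proof. by move=> D; apply: dist_extend (dist_rotl D). Qed.

Lemma dist_comp02 X Y Z (f : hom X Y) (g : hom Y Z) (h : hom Z (shift C X)) :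
  dist f g h -> h \oc g = zero_map _ _.
Proof. by move=> D; apply: dist_comp0 (dist_rotl D). Qed.

Lemma shift_opp X Y (f : hom X Y) :
  fmap (shift C) (opp_map f) = opp_map (fmap (shift C) f).
Proof.
have := shift_linear (-1) f (zero_map _ _).
by rewrite shift0 !add_map0 !scaleN1_map.
Qed.

(** The fibre is Z[-1]. As [1] is only an equivalence, [h] is first transported along Z[-1][1] -> Z
    and then desuspended; the sign cancels the one in the rotation axiom. *)
Lemma dist_fiber X Y Z (f : hom X Y) (g : hom Y Z) (h : hom Z (shift C X)) :
  dist f g h -> exists K (k : hom K X) (m : hom Y (shift C K)),
    dist k f m /\ isomorphic (shift C K) Z.
Proof.
move=> D; have iso := shift_unshift Z; have [u [v [vu uv]]] := iso.
have [k' k'E] := shift_full (h \oc u).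
exists (unshift C Z), (opp_map k'), (v \oc g); split=> //.
apply/dist_rot; rewrite shift_opp opp_mapK k'E.
apply: (dist_iso (u := idm _) (v := idm _) (w := v)) D;
  rewrite ?comp1m ?fmap1 ?compm1 //; try exact: iso_idm.
  by exists u.
by rewrite comp1m -compA uv compm1.
Qed.

(* Obtained from the octahedra on X0 -> X -> Y, on X0 -> Y0 -> Y and on the
   resulting Z0 -> W -> Z, where W is the cone of X0 -> Y. *)
Lemma dist_3x3 X Y Z (f : hom X Y) (g : hom Y Z) (h : hom Z (shift C X))
    X0 X1 (a : hom X0 X) (a1 : hom X X1) (a2 : hom X1 (shift C X0))
    Y0 Y1 (b : hom Y0 Y) (b1 : hom Y Y1) (b2 : hom Y1 (shift C Y0))
    Z0 (p : hom X0 Y0) (c : hom Y0 Z0) (d : hom Z0 (shift C X0)) :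
  dist f g h -> dist a a1 a2 -> dist b b1 b2 -> dist p c d ->
  f \oc a = b \oc p ->
  exists Z1 (z : hom Z0 Z) (z1 : hom Z Z1) (z2 : hom Z1 (shift C Z0))
    (p1 : hom X1 Y1) (c1 : hom Y1 Z1) (d1 : hom Z1 (shift C X1)),
    [/\ dist z z1 z2, dist p1 c1 d1, z \oc c = g \oc b, c1 \oc b1 = z1 \oc g
      & p1 \oc a1 = b1 \oc f].
Proof.
move=> Df Da Db Dp fa; have [W [q [e Dq]]] := dist_cone (f \oc a).
have [x [y [Dxy xa _ yq _]]] := dist_oct Da Dq Df.
rewrite fa in Dq; have [s [t [Dst sc _ tq _]]] := dist_oct Dp Dq Db.
have [Z1 [z1 [z2 Dz]]] := dist_cone (y \oc s).
(* The cones of [s], [y] and [y \oc s] are Y1, X1[1] and Z1, so this octahedron, rotated back, is a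
   triangle X1 -> Y1 -> Z1. *)
have [r [o [Dro rt _ _ _]]] := dist_oct Dst Dz (dist_rotl Dxy).
exists Z1, (y \oc s), z1, z2, (t \oc x), r, o; split=> //.
- by apply/dist_rot; rewrite fmapM -comp_oppr.
- by rewrite -compA sc compA yq.
- by rewrite -tq compA rt -compA yq.
- by rewrite -compA xa compA tq.
Qed.

Lemma dist_mid_no_maps_to X Y Z (f : hom X Y) (g : hom Y Z)
    (h : hom Z (shift C X)) W :
  dist f g h -> no_maps W X -> no_maps W Z -> no_maps W Y.
Proof.
move=> D WX WZ k; have [l <-] := dist_lift D (WZ (g \oc k)).
by rewrite (WX l) compm0.
Qed.

Lemma dist_mid_no_maps_from X Y Z (f : hom X Y) (g : hom Y Z)
    (h : hom Z (shift C X)) W :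
  dist f g h -> no_maps X W -> no_maps Z W -> no_maps Y W.
Proof.
move=> D XW ZW k; have [l <-] := dist_extend D (XW (k \oc f)).
by rewrite (ZW l) comp0m.
Qed.

Lemma no_maps_retract_from X Y W : retract X Y -> no_maps Y W -> no_maps X W.
Proof.
by move=> [i [p pi]] YW f; rewrite -[f]compm1 -pi compA (YW (f \oc p)) comp0m.
Qed.

Lemma no_maps_shift_iff X Y : no_maps (shift C X) (shift C Y) <-> no_maps X Y.
Proof.
split=> [XY f|]; last exact: no_maps_shift.
by apply: shift_faithful; rewrite shift0; apply: XY.
Qed.

Lemma no_maps_id X : no_maps X X -> is_zero X.
Proof.
move=> /(_ (idm X)) e W; split=> f; first by rewrite -[f]comp1m e comp0m.
by rewrite -[f]compm1 e compm0.
Qed.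

End Triangles.

(** * Orthogonality, extensions and shifts of weight classes *)

Section WeightClasses.
Variables (R : comPzRingType) (C : tricat R) (w : weight_structure C).
Implicit Types (X Y Z L N W : C) (i m n : int).

Lemma w_le0_iso X Y : isomorphic X Y -> w_le0 w X -> w_le0 w Y.
Proof. by move=> /iso_sym/iso_retract; apply: w_le0_retract. Qed.

Lemma w_ge0_iso X Y : isomorphic X Y -> w_ge0 w X -> w_ge0 w Y.
Proof. by move=> /iso_sym/iso_retract; apply: w_ge0_retract. Qed.

Lemma w_leE i X : w_le w i X <-> w_le0 w (shiftz (- i) X).
Proof. exact/shiftedE/w_le0_iso. Qed.

Lemma w_geE i X : w_ge w i X <-> w_ge0 w (shiftz (- i) X).
Proof. exact/shiftedE/w_ge0_iso. Qed.

Lemma w_le_retract i X Y : retract X Y -> w_le w i Y -> w_le w i X.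
Proof.
by move=> /(retract_shiftz (- i)) r /w_leE /(w_le0_retract r) /w_leE.
Qed.

Lemma w_ge_retract i X Y : retract X Y -> w_ge w i Y -> w_ge w i X.
Proof.
by move=> /(retract_shiftz (- i)) r /w_geE /(w_ge0_retract r) /w_geE.
Qed.

Lemma w_ge_iso i X Y : isomorphic X Y -> w_ge w i X -> w_ge w i Y.
Proof. by move=> /iso_sym/iso_retract; apply: w_ge_retract. Qed.

(** In an i-weight decomposition of X the map L -> X vanishes, so [idm X] extends over N and X is a
    retract of N. With the dual [w_le_perp], the two classes are each other's full orthogonals,
    whence monotonicity and closure under extensions. *)
Lemma w_ge_perp i X :
  (forall L, w_le w i L -> no_maps L X) -> w_ge w (i + 1) X.
Proof.
move=> LX; have [L [N [f [g [h [D leL geN]]]]]] := has_dec_all w i X.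
have [|l lg] := dist_extend (k := idm X) D; first by rewrite comp1m; apply: LX.
by apply: w_ge_retract geN; exists g, l.
Qed.

Lemma w_le_perp i X :
  (forall N, w_ge w (i + 1) N -> no_maps X N) -> w_le w i X.
Proof.
move=> XN; have [L [N [f [g [h [D leL geN]]]]]] := has_dec_all w i X.
have [|l fl] := dist_lift (k := idm X) D; first by rewrite compm1; apply: XN.
by apply: w_le_retract leL; exists l, f.
Qed.

Lemma w_ge_mono m n X : m <= n -> w_ge w n X -> w_ge w m X.
Proof.
move=> mn geX; rewrite -(subrK 1 m); apply: w_ge_perp => L leL.
by apply: (w_no_maps _ leL geX); lia.
Qed.

Lemma w_le_mono m n X : m <= n -> w_le w m X -> w_le w n X.
Proof.
move=> mn leX; apply: w_le_perp => N geN.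
by apply: (w_no_maps _ leX geN); lia.
Qed.

Lemma w_ge_ext i X Y Z (f : hom X Y) (g : hom Y Z) (h : hom Z (shift C X)) :
  dist f g h -> w_ge w i X -> w_ge w i Z -> w_ge w i Y.
Proof.
move=> D geX geZ; rewrite -(subrK 1 i); apply: w_ge_perp => L leL.
apply: (dist_mid_no_maps_to D);
  by apply: (w_no_maps (w := w) (m := i - 1) (n := i)) => //; lia.
Qed.

Lemma w_le_ext i X Y Z (f : hom X Y) (g : hom Y Z) (h : hom Z (shift C X)) :
  dist f g h -> w_le w i X -> w_le w i Z -> w_le w i Y.
Proof.
move=> D leX leZ; apply: w_le_perp => N geN.
apply: (dist_mid_no_maps_from D);
  by apply: (w_no_maps (w := w) (m := i) (n := i + 1)) => //; lia.
Qed.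

Lemma w_ge_shift i X : w_ge w i X -> w_ge w (i + 1) (shift C X).
Proof. exact: shifted_shift. Qed.

Lemma w_ge_unshift i X : w_ge w (i + 1) (shift C X) -> w_ge w i X.
Proof.
move=> /shifted_unshift; rewrite addrK.
by apply: w_ge_iso; apply: unshift_shift.
Qed.

Lemma w_ge_shiftz i j X : w_ge w i X -> w_ge w (i + j) (shiftz j X).
Proof.
move=> [Y [geY XY]]; exists Y; split=> //.
exact: iso_trans (shiftz_iso j XY) (shiftzD _ _ _).
Qed.

Lemma w_le_shiftz i j X : w_le w i X -> w_le w (i + j) (shiftz j X).
Proof.
move=> [Y [leY XY]]; exists Y; split=> //.
exact: iso_trans (shiftz_iso j XY) (shiftzD _ _ _).
Qed.

Lemma w_ge0E X : w_ge w 0 X <-> w_ge0 w X.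
Proof. exact: w_geE. Qed.

Lemma w_le0E X : w_le w 0 X <-> w_le0 w X.
Proof. exact: w_leE. Qed.

Lemma w_ge_cone i X Y Z (f : hom X Y) (g : hom Y Z) (h : hom Z (shift C X)) :
  dist f g h -> w_ge w (i - 1) X -> w_ge w i Y -> w_ge w i Z.
Proof.
move=> D geX geY; apply: (w_ge_ext (dist_rotl D) geY).
by have := w_ge_shift geX; rewrite subrK.
Qed.

Lemma w_le_cone i X Y Z (f : hom X Y) (g : hom Y Z) (h : hom Z (shift C X)) :
  dist f g h -> w_le w (i - 1) X -> w_le w i Y -> w_le w i Z.
Proof.
move=> D leX leY; apply: (w_le_ext (dist_rotl D) leY).
by have := w_le_shift leX; rewrite subrK.
Qed.

Lemma w_ge_fiber i X Y Z (f : hom X Y) (g : hom Y Z) (h : hom Z (shift C X)) :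
  dist f g h -> w_ge w i Y -> w_ge w (i + 1) Z -> w_ge w i X.
Proof.
move=> D geY geZ; apply: w_ge_unshift.
apply: (w_ge_ext (dist_rotl (dist_rotl D)) geZ).
exact: w_ge_shift.
Qed.

End WeightClasses.

(** * Finiteness of the virtual truncations *)

Section ImageFunctorFinite.
Variables (R : comPzRingType) (cohR : coherent R) (C : tricat R).
Variables (H : presheaf C) (finH : finite_functor H).
Variables (P Q : C -> C) (c : forall X, hom (P X) (Q X)).
Variables (p : forall X Y, hom X Y -> hom (P X) (P Y)).
Variables (q : forall X Y, hom X Y -> hom (Q X) (Q Y)).
Hypothesis cp : forall X Y (f : hom X Y), c Y \oc p f = q f \oc c X.
Hypothesis cp1 : forall X, c X \oc p (idm X) = c X.
Hypothesis cpM : forall X Y Z (g : hom Y Z) (f : hom X Y),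
  c Z \oc p (g \oc f) = c Z \oc (p g \oc p f).
Hypothesis cp_linear : forall X Y a (f g : hom X Y),
  c Y \oc p (add_map (scale_map a f) g) =
  c Y \oc add_map (scale_map a (p f)) (p g).
Hypothesis cp_exact : forall X Y Z (f : hom X Y) (g : hom Y Z)
  (h : hom Z (shift C X)), dist f g h ->
  exists W (e : hom (Q Y) W) (d : hom W (shift C (P X))) (r : hom (Q Z) W),
    dist (c Y \oc p f) e d /\ r \oc (c Z \oc p g) = e \oc c Y.
(** On remote shifts of M the connecting map is zero on one side of the weights, and on the other it
    factors through the shift itself, where H vanishes. *)
Hypothesis c_vanish : forall M, exists a b : int, forall i : int,
  i < a \/ b < i -> c (shiftz (- i) M) = zero_map _ _ \/
    exists (s : hom (shiftz (- i) M) (Q (shiftz (- i) M))) t,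
      c (shiftz (- i) M) = s \oc t.

Local Notation T := (image_functor H cp cp1 cpM).

Lemma image_functor_linear : linear_presheaf T.
Proof.
move=> X Y a f g x; have [y yx] := image_modP x; apply: image_val_inj.
rewrite image_val_linear /= -yx -!pmapM cp_linear compPr.
exact: (ff_linear finH).
Qed.

Lemma pmap_zero X Y (x : pobj H Y) : pmap H (zero_map X Y) x = 0.
Proof.
have := ff_linear finH (-1) (zero_map X Y) (zero_map X Y) x.
by rewrite scale_map0 add_map0 scaleN1r addNr.
Qed.

(** A class on Q Y that dies on P X extends, by exactness of H, to the cone W of P X -> Q Y;
    restricting it along [r] : Q Z -> W gives the element over Z. *)
Lemma image_functor_cohomological : cohomological T.
Proof.
move=> X Y Z f g h D y; split=> [fy|[z <-]]; last first.
  rewrite -pmapM (dist_comp0 D).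
  have := image_functor_linear (-1) (zero_map X Z) (zero_map X Z) z.
  by rewrite scale_map0 add_map0 scaleN1r addNr.
have [W [e [d [r [De rE]]]]] := cp_exact D.
have [y1 y1y] := image_modP y.
have /(ff_cohomological finH De)[w ew] : pmap H (c Y \oc p f) y1 = 0.
  rewrite pmapM y1y; have := congr1 (@image_val _ _ _ _) fy.
  by rewrite image_val0.
exists (to_image _ (pmap H r w)); apply: image_val_inj.
rewrite -y1y -ew -pmapM -rE.
by rewrite [RHS]pmapM [RHS]pmapM.
Qed.

Lemma image_functor_finite : finite_functor T.
Proof.
split.
- exact: image_functor_linear.
- exact: image_functor_cohomological.
- by move=> M; apply: fp_image => //; first apply: fp_fin_gen; apply: (ff_fp finH).
- move=> M; have [a [b vc]] := c_vanish M.
  have [a' [b' vH]] := ff_vanish finH M.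
  exists (Order.min a a'), (Order.max b b') => i ib x.
  have ic : i < a \/ b < i by lia.
  have {}ib : i < a' \/ b' < i by lia.
  have [y yx] := image_modP x; apply: image_val_inj; rewrite image_val0 -yx.
  case: (vc i ic) => [->|[s [t ->]]]; first exact: pmap_zero.
  by rewrite pmapM (vH i ib (pmap H s y)) linear0.
Qed.

End ImageFunctorFinite.

Section TruncationsFinite.
Variables (R : comPzRingType) (cohR : coherent R) (C : tricat R).
Variables (w : weight_structure C) (wb : w_bounded w) (D : weight_decs w).
Variables (H : presheaf C) (finH : finite_functor H).
Implicit Types (X Y Z M : C) (m n i : int).

(** The identity of X lifts to w_{<= m+1} X, because X has no maps to the complement; uniqueness of
    connecting morphisms identifies the composite through X with the chosen one. *)
Lemma dec_le_factor m X : w_le w m X ->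
  exists s, dm_le (dec_conn D m X) = s \oc wd_in (D m X).
Proof.
move=> leX.
have [|s sE] := dist_lift (k := idm X) (wd_dist (D (m + 1) X)).
  by rewrite compm1; apply: (w_no_maps _ leX (wd_geP _)); lia.
exists s; apply: (dec_le_uniq (lt_succ m)).
by rewrite -dm_in compA sE.
Qed.

Lemma dec_le_zero m X : w_ge w (m + 1) X ->
  dm_le (dec_conn D m X) = zero_map _ _.
Proof.
move=> geX; apply: (dec_le_uniq (lt_succ m)); rewrite -dm_in comp1m compm0.
by apply: (w_no_maps _ (wd_leP _) geX); lia.
Qed.

Lemma dec_ge_factor m X : w_ge w (m + 1) X ->
  exists t, dm_ge (dec_conn D m X) = wd_out (D (m + 1) X) \oc t.
Proof.
move=> geX.
have [|t tE] := dist_extend (k := idm X) (wd_dist (D m X)).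
  by rewrite comp1m; apply: (w_no_maps _ (wd_leP _) geX); lia.
exists t; apply: (dec_ge_uniq (lt_succ m)).
by rewrite dm_out compm1 -compA tE compm1.
Qed.

Lemma dec_ge_zero m X : w_le w (m + 1) X ->
  dm_ge (dec_conn D m X) = zero_map _ _.
Proof.
move=> leX; apply: (dec_ge_uniq (lt_succ m)); rewrite dm_out compm1 comp0m.
by apply: (w_no_maps _ leX (wd_geP _)); lia.
Qed.

(* The source of exactness: a class on the decomposition of Y that vanishes on
   that of X extends to the cone of the two, which decomposes Z. *)
Lemma dec_cone m X Y Z (f : hom X Y) (g : hom Y Z) (h : hom Z (shift C X)) :
  dist f g h -> exists (e : weight_dec w (m + 1) Z)
    (c0 : hom (wd_le (D (m + 1) Y)) (wd_le e)) d0
    (c1 : hom (wd_ge (D (m + 1) Y)) (wd_ge e)) d1,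
    [/\ dist (dm_le (dec_conn D m Y) \oc dm_le (dec_map D m f)) c0 d0,
        dist (dm_ge (dec_conn D m Y) \oc dm_ge (dec_map D m f)) c1 d1,
        wd_in e \oc c0 = g \oc wd_in (D (m + 1) Y) &
        c1 \oc wd_out (D (m + 1) Y) = wd_out e \oc g].
Proof.
move=> Df.
have [Z0 [c [d Dc]]] :=
  dist_cone (dm_le (dec_conn D m Y) \oc dm_le (dec_map D m f)).
have e : f \oc wd_in (D m X) = wd_in (D (m + 1) Y) \oc
    (dm_le (dec_conn D m Y) \oc dm_le (dec_map D m f)).
  by rewrite compA -dm_in comp1m -dm_in.
have [Z1 [z [z1 [z2 [p1 [c1 [d1 [Dz Dp zc cb pa]]]]]]]] :=
  dist_3x3 Df (wd_dist (D m X)) (wd_dist (D (m + 1) Y)) Dc e.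
have leZ : w_le w (m + 1) Z0.
  by apply: (w_le_cone Dc); rewrite ?addrK; apply: wd_leP.
have geZ : w_ge w (m + 1 + 1) Z1.
  by apply: (w_ge_cone Dp); rewrite ?addrK; apply: wd_geP.
have p1E : p1 = dm_ge (dec_conn D m Y) \oc dm_ge (dec_map D m f).
  apply: (dec_ge_uniq (lt_succ m)).
  by rewrite pa -compA dm_out compA dm_out compm1.
by exists (WeightDec Dz leZ geZ), c, d, c1, d1; split=> //; rewrite -p1E.
Qed.

Lemma tau_le_finite n : finite_functor (tau_le D H n).
Proof.
apply: image_functor_finite => //.
- move=> X Y a f g; apply: conn_le_eq.
  by rewrite -dm_in compPr compPl -!dm_in.
- move=> X Y Z f g h /(dec_cone n)[e [c0 [d0 [_ [_ [D0 _ e0 _]]]]]].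
  (* The cone carries its own (n+1)-weight decomposition of Z, to which the chosen one is
     compared. *)
  pose r := dec_morphism (idm Z) (D (n + 1) Z) e (lexx _).
  exists (wd_le e), c0, d0, (dm_le r); split=> //.
  apply: (dec_le_uniq (lt_succ n)).
  rewrite !compA -dm_in comp1m -dm_in comp1m -dm_in e0.
  by rewrite -compA -dm_in comp1m.
- move=> M; have [a geM] := wb.1 M; have [b leM] := wb.2 M.
  (* The weights of M[-i] lie between a - i and b - i: for i < a - n - 1 it is in w_{>= n+1}, for i
     > b - n in w_{<= n}. *)
  exists (a - n - 1), (b - n) => i [lt_i|lt_i]; [left|right].
    apply: dec_le_zero; apply: w_ge_mono (w_ge_shiftz (- i) geM); lia.
  have [|s ->] := @dec_le_factor n (shiftz (- i) M); last by exists s, (wd_in _).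
  by apply: w_le_mono (w_le_shiftz (- i) leM); lia.
Qed.

Lemma tau_ge_finite n : finite_functor (tau_ge D H n).
Proof.
apply: image_functor_finite => //.
- move=> X Y a f g; apply: conn_ge_eq.
  by rewrite dm_out compPr compPl !dm_out.
- move=> X Y Z f g h /(dec_cone (n - 2))[e [_ [_ [c1 [d1 [_ D1 _ e1]]]]]].
  pose r := dec_morphism (idm Z) (D (n - 2 + 1) Z) e (lexx _).
  exists (wd_ge e), c1, d1, (dm_ge r); split=> //.
  apply: (dec_ge_uniq (lt_succ (n - 2))).
  rewrite -!compA dm_out (compA (dm_ge (dec_conn _ _ _))) dm_out compm1.
  by rewrite compA dm_out compm1 dm_out compm1 e1.
- move=> M; have [a geM] := wb.1 M; have [b leM] := wb.2 M.
  exists (a - n + 1), (b - n + 1) => i [lt_i|lt_i]; [right|left].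
    have [|t ->] := @dec_ge_factor (n - 2) (shiftz (- i) M);
      last by exists (wd_out _), t.
    by apply: w_ge_mono (w_ge_shiftz (- i) geM); lia.
  apply: dec_ge_zero; apply: w_le_mono (w_le_shiftz (- i) leM); lia.
Qed.

End TruncationsFinite.

(** * The adjacent t-structure *)

Lemma presheaf_isoP (R : comPzRingType) (C : lincat R) (H K : presheaf C) :
  nat_isomorphic H K ->
  exists (a : forall X, {linear pobj H X -> pobj K X})
    (b : forall X, {linear pobj K X -> pobj H X}),
    [/\ forall X y, b X (a X y) = y, forall X y, a X (b X y) = y &
        forall X Y (f : hom X Y) y, a X (pmap H f y) = pmap K f (a Y y)].
Proof.
move=> [a isoa]; exists a, (fun X => projT1 (cid (isoa X))); split=> X.
- move=> y; case: cid => b /= [ba _].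
  exact: (congr1 (fun f : {linear pobj H X -> pobj H X} => f y) ba).
- move=> y; case: cid => b /= [_ ab].
  exact: (congr1 (fun f : {linear pobj K X -> pobj K X} => f y) ab).
- move=> Y f y; have n := @naturality _ _ _ _ a Y X f.
  exact: (congr1 (fun f : {linear pobj H Y -> pobj K X} => f y) n).
Qed.

Section RightAdjacent.
Variables (R : comPzRingType) (cohR : coherent R) (C : tricat R).
Variables (satC : saturated C) (w : weight_structure C) (wb : w_bounded w).
Implicit Types (X Y Z L M N : C) (i j k n : int).

Lemma yoneda_finite M : finite_functor (yoneda M).
Proof. exact/satC/representable_yoneda. Qed.

Lemma tau_representable (D : weight_decs w) i M :
  representable (tau_le D (yoneda M) i) /\
  representable (tau_ge D (yoneda M) i).
Proof.
have finM := yoneda_finite M.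
by split; apply/satC; [apply: tau_le_finite | apply: tau_ge_finite].
Qed.

(* The object representing tau_{>= 0} of C(-, M), and the map to M induced by
   the natural transformation tau_{>= 0} C(-, M) -> C(-, M). *)
Lemma tau_ge_object (D : weight_decs w) M :
  exists L (l : hom L M)
    (a : forall X, {linear pobj (tau_ge D (yoneda M) 0) X -> lhom C X L}),
    (forall X (x : hom X L), exists y, a X y = x) /\
    (forall X y, l \oc (a X y : hom X L) =
       (image_val y : hom (wd_ge (D (0 - 2) X)) M) \oc wd_out (D (0 - 2) X)).
Proof.
have [_ [L isoL]] := tau_representable D 0 M.
have [a [b [ba ab an]]] := presheaf_isoP isoL.
(* [e] is the universal class, the one matching [idm L]; by Yoneda every class y is its restriction
   along a X y. *)
pose e := b L (@idm C L); pose v := image_val e : hom (wd_ge (D (0 - 2) L)) M.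
exists L, (v \oc wd_out (D (0 - 2) L)), a; split=> [X x|X y].
  by exists (b X x); apply: ab.
set x : hom X L := a X y.
have -> : y = pmap (tau_ge D (yoneda M) 0) x e.
  rewrite -[LHS]ba -[RHS]ba an ab; congr (b X _).
  by rewrite -[LHS](@comp1m C).
by rewrite -compA -(dm_out (dec_map D (0 - 2) x)) compA.
Qed.

(** For L representing tau_{>= 0} of C(-, M), C(X, L) -> C(X, M) is onto for X in w_{>= 0} and
    injective for X in w_{>= -1}. Exactness then kills the maps from w_{>= 0} to the cone. *)
Lemma w_ge0_truncation M : exists L N (f : hom L M) (g : hom M N)
    (h : hom N (shift C L)),
  [/\ dist f g h, w_ge w 0 L & forall X, w_ge w 0 X -> no_maps X N].
Proof.
have [D] := weight_decs_exist w.
have [L [l [a [a_surj la]]]] := tau_ge_object D M.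
have geL : w_ge w 0 L.
  rewrite -[0](subrK 1); apply: w_ge_perp => X leX x.
  have [y <-] := a_surj X x; suff -> : y = 0 by rewrite linear0.
  have [z zy] := image_modP y; apply: image_val_inj; rewrite image_val0 -zy.
  by rewrite dec_ge_zero //= /precomp compm0.
(* Here X is a retract of w_{>= 0} X, so m extends there and defines a class. *)
have lsurj X (m : hom X M) : w_ge w 0 X -> exists x, l \oc x = m.
  move=> geX; have [|r rE] := dist_extend (k := idm X) (wd_dist (D (0 - 2 + 1) X)).
    by rewrite comp1m; apply: (w_no_maps _ (wd_leP _) geX); lia.
  pose y := to_image (pmap (yoneda M) (dm_ge (dec_conn D (0 - 2) X))) (m \oc r).
  exists (a X y); rewrite la.
  transitivity (m \oc r \oc dm_ge (dec_conn D (0 - 2) X) \oc wd_out (D (0 - 2) X)).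
    by [].
  by rewrite -compA dm_out compm1 -compA rE compm1.
(* The bound -1 serves the desuspensions of objects of w_{>= 0}. For such X the connecting map
   factors through X, so a class is determined by the map X -> M that it induces. *)
have linj X (x : hom X L) : w_ge w (-1) X -> l \oc x = zero_map _ _ ->
    x = zero_map _ _.
  move=> geX; have [y <-] := a_surj X x; rewrite la.
  have [z zy] := image_modP y; pose z' : hom (wd_ge (D (0 - 2 + 1) X)) M := z.
  have {}zy : image_val y = z' \oc dm_ge (dec_conn D (0 - 2) X) by rewrite -zy.
  rewrite zy -compA dm_out compm1 => z0; suff -> : y = 0 by rewrite linear0.
  apply: image_val_inj; rewrite image_val0 zy.
  by have [t ->] := dec_ge_factor D (m := 0 - 2) geX; rewrite compA z0 comp0m.
have [N [g [h D']]] := dist_cone l.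
exists L, N, l, g, h; split=> // X geX.
apply: (no_maps_iso (iso_sym (shift_unshift X)) (iso_refl N)) => k.
have geX' : w_ge w (-1) (unshift C X) by have := shifted_unshift geX; rewrite sub0r.
have [x xE] := shift_full (h \oc k).
have hk : h \oc k = zero_map _ _.
  rewrite -xE (linj _ x) ?shift0 //; apply: shift_faithful.
  rewrite fmapM xE compA shift0.
  have := dist_comp02 (dist_rotl D'); rewrite comp_oppl => e.
  by rewrite -[_ \oc h](@opp_mapK R C) e opp_map0 comp0m.
have [m mk] := dist_lift2 D' hk.
have [|x' x'E] := lsurj _ m.
  by apply: w_ge_iso geX; apply/iso_sym/shift_unshift.
by rewrite -mk -x'E compA (dist_comp0 D') comp0m.
Qed.

(** This choice is forced: in any t-structure right adjacent to w, the class [t_le0] is this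
    orthogonal. *)
Definition adj_le0 Y := forall X, w_ge w 1 X -> no_maps X Y.

Lemma adj_le0_iso X Y : isomorphic X Y -> adj_le0 X -> adj_le0 Y.
Proof.
move=> XY leX W geW.
exact: no_maps_iso (iso_refl W) (iso_sym XY) (leX W geW).
Qed.

Lemma adj_le0_shift X : adj_le0 X -> shifted adj_le0 1 X.
Proof.
move=> leX; exists (unshift C X); split; last exact/iso_sym/shift_unshift.
move=> W geW; apply/no_maps_shift_iff.
apply: no_maps_iso (iso_refl _) (shift_unshift X) (leX _ _).
by apply: w_ge_mono (w_ge_shift geW); lia.
Qed.

Lemma adj_orth : orthogonal (shifted (w_ge0 w) 1) adj_le0.
Proof. by move=> X Y f geX leY; apply: leY. Qed.

Lemma adj_dec M : exists L N (f : hom L M) (g : hom M N) (h : hom N (shift C L)),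
  [/\ dist f g h, w_ge0 w L & shifted adj_le0 (-1) N].
Proof.
have [L [N [f [g [h [D geL leN]]]]]] := w_ge0_truncation M.
exists L, N, f, g, h; split=> //; first exact/w_ge0E.
exists (shift C N); split; last exact/iso_sym/unshift_shift.
move=> W geW; have geW' := shifted_unshift geW.
apply: no_maps_iso (iso_sym (shift_unshift W)) (iso_refl _) _.
exact/no_maps_shift_iff/leN.
Qed.

Definition adjacent_t_structure : t_structure C :=
  TStructure adj_le0_iso (@w_ge0_iso _ _ w) adj_le0_shift
    (@w_ge0_shift _ _ w) adj_orth adj_dec.

(* Here L is the truncation t_{>= 0} of M[-k]. *)
Definition truncation_vanishes M X := exists k0, forall k, k0 <= k ->
  forall L N (f : hom L (shiftz (- k) M)) (g : hom (shiftz (- k) M) N) h,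
  dist f g h -> w_ge w 0 L -> (forall W, w_ge w 0 W -> no_maps W N) ->
  forall j, no_maps X (shiftz j L).

Lemma truncation_vanishes_mid M X Y Z (f : hom X Y) (g : hom Y Z) h :
  dist f g h -> truncation_vanishes M X -> truncation_vanishes M Z ->
  truncation_vanishes M Y.
Proof.
move=> D [a aX] [b bZ]; exists (Order.max a b) => k ak L N f' g' h' D' geL leN j.
apply: (dist_mid_no_maps_from D).
  by apply: aX D' geL leN _; lia.
by apply: bZ D' geL leN _; lia.
Qed.

(** X[-j] is pure of weight i - j. If this is negative, orthogonality to L suffices. Otherwise a map
    X[-j] -> L dies in M[-k], since j - k < a by the choice of the bound on k; so its shift comes
    from a map X[-j][1] -> N, which is zero. *)
Lemma truncation_vanishes_pure M i X :
  w_le w i X -> w_ge w i X -> truncation_vanishes M X.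
Proof.
move=> leX geX; have [a [b vM]] := ff_vanish (yoneda_finite M) X.
exists (i - a + 1) => k ak L N f g h D geL leN j.
suff vL : no_maps (shiftz (- j) X) L.
  apply: no_maps_iso (iso_sym _) (iso_refl _) (no_maps_shiftz (i := j) vL).
  by apply: shiftz_eq0; rewrite addNr.
have := w_le_shiftz (- j) leX; have := w_ge_shiftz (- j) geX.
case: (ltP (i - j) 0) => [lt_ij _ le|le_ji ge _]; first exact: w_no_maps le geL.
move=> x.
have [|y yE] := dist_lift3 D (k := fmap (shift C) x).
  rewrite -fmapM; suff -> : f \oc x = zero_map _ _ by rewrite shift0.
  suff v : no_maps (shiftz (- j) X) (shiftz (- k) M) by apply: v.
  have v : no_maps (shiftz (- (j - k)) X) M by move=> m; apply: vM; left; lia.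
  apply: no_maps_iso (iso_sym _) (iso_refl _) (no_maps_shiftz (i := - k) v).
  by have := shiftzD X (- (j - k)) (- k); congr (isomorphic _ (shiftz _ _)); lia.
apply: shift_faithful; rewrite -yE shift0.
suff -> : y = zero_map _ _ by rewrite compm0.
by apply: leN; apply: w_ge_mono (w_ge_shift ge); lia.
Qed.

(** Induction on the length of the weight interval of X: an a-weight decomposition splits off a
    piece pure of weight a. *)
Lemma truncation_vanishes_all M X : truncation_vanishes M X.
Proof.
have [a geX] := wb.1 X; have [b leX] := wb.2 X.
have {leX b} [n leX] : exists n : nat, w_le w (a + n%:Z) X.
  by exists (absz (b - a)%R); apply: w_le_mono leX; lia.
elim: n X a geX leX => [|n IHn] X a geX leX.
  by apply: truncation_vanishes_pure geX; rewrite addr0 in leX.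
have [L [N [f [g [h [D leL geN]]]]]] := has_dec_all w a X.
apply: (truncation_vanishes_mid D).
  exact: truncation_vanishes_pure leL (w_ge_fiber D geX geN).
apply: IHn geN _; apply: (w_le_cone D); first by apply: w_le_mono leL; lia.
by apply: w_le_mono leX; lia.
Qed.

Lemma dense_left_perp L :
  dense_subcategory (fun X => forall j, no_maps X (shiftz j L)).
Proof.
have shiftP X : (forall j, no_maps X (shiftz j L)) ->
    forall j, no_maps (shift C X) (shiftz j L).
  move=> XL j; apply: no_maps_iso (iso_refl _) _ (no_maps_shift (XL (j - 1))).
  by have := shiftzS L (j - 1); rewrite subrK => /iso_sym.
split=> //.
- by move=> Z zZ j f; apply: (zZ _).2.
- move=> X XL j; apply/no_maps_shift_iff.
  exact: no_maps_iso (shift_unshift X) (shiftzS _ _) (XL _).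
- move=> X Y Z f g h D XL YL j.
  by apply: (dist_mid_no_maps_from (dist_rotl D)) (YL j) (shiftP _ XL j).
- by move=> X Y XY YL j; apply: no_maps_retract_from XY (YL j).
Qed.

(** The objects without maps to any shift of L form a dense subcategory. It contains G, hence L
    itself, so L = 0 and M[-k0] is orthogonal to w_{>= 0}. *)
Lemma adjacent_t_bounded (G : C) :
  densely_generated G -> t_bounded adjacent_t_structure.
Proof.
move=> genG; split=> M; first exact: wb.1 M.
have [k0 vG] := truncation_vanishes_all M G; exists k0.
have [L [N [f [g [h [D geL leN]]]]]] := w_ge0_truncation (shiftz (- k0) M).
have vL := genG _ (dense_left_perp L) (vG k0 (lexx _) _ _ _ _ _ D geL leN) L 0.
have Mk X : w_ge w 0 X -> no_maps X (shiftz (- k0) M).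
  move=> geX x; have [l <-] := dist_lift D (leN X geX (g \oc x)).
  by rewrite ((no_maps_id vL X).1 l) compm0.
apply/(shiftedE _ _ adj_le0_iso) => X geX; apply: Mk.
by apply: w_ge_mono geX.
Qed.

End RightAdjacent.

(** * The heart *)

Lemma fully_faithful_equivalence (C D : category) (F : functor C D) :
  (forall X Y (f g : hom X Y), fmap F f = fmap F g -> f = g) ->
  (forall X Y (k : hom (F X) (F Y)), exists f, fmap F f = k) ->
  (forall Y, exists X, isomorphic (F X) Y) ->
  is_equivalence F.
Proof.
move=> faithF fullF essF.
pose Go Y := projT1 (cid (essF Y)).
pose e Y : hom (F (Go Y)) Y := projT1 (cid (projT2 (cid (essF Y)))).
have iso_e Y : is_iso (e Y) := projT2 (cid (projT2 (cid (essF Y)))).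
pose e' Y := projT1 (cid (iso_e Y)).
have [e'e ee'] : (forall Y, e' Y \oc e Y = idm _) /\ (forall Y, e Y \oc e' Y = idm _).
  by split=> Y; have [] := projT2 (cid (iso_e Y)).
pose lift X Y (k : hom (F X) (F Y)) : hom X Y := projT1 (cid (fullF X Y k)).
have liftE X Y (k : hom (F X) (F Y)) : fmap F (lift X Y k) = k.
  exact: projT2 (cid (fullF X Y k)).
pose Gm X Y (f : hom X Y) : hom (Go X) (Go Y) := lift _ _ (e' Y \oc f \oc e X).
have Gm1 X : Gm X X (idm X) = idm (Go X).
  by apply: faithF; rewrite liftE compm1 e'e fmap1.
have GmM X Y Z (g : hom Y Z) (f : hom X Y) :
    Gm X Z (g \oc f) = Gm Y Z g \oc Gm X Y f.
  apply: faithF; rewrite fmapM !liftE !compA; congr (_ \oc _ \oc _).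
  by rewrite -(compA _ (e Y)) ee' compm1.
pose G := Functor Gm1 GmM; exists G; split.
  have nat X Y (f : hom X Y) :
      lift _ _ (e (F Y)) \oc fmap (fcomp G F) f =
      fmap (fid C) f \oc lift _ _ (e (F X)).
    by apply: faithF; rewrite !fmapM /= !liftE !compA ee' comp1m.
  exists (@NatTrans _ _ (fcomp G F) (fid C) (fun X => lift _ _ (e (F X))) nat).
  move=> X; exists (lift _ _ (e' (F X))).
  by split; apply: faithF; rewrite fmapM !liftE fmap1 ?e'e ?ee'.
have nat X Y (f : hom X Y) :
    e Y \oc fmap (fcomp F G) f = fmap (fid D) f \oc e X.
  rewrite -[fmap (fcomp F G) f]/(fmap F (Gm X Y f)) liftE !compA.
  by rewrite ee' comp1m.
by exists (@NatTrans _ _ (fcomp F G) (fid D) e nat) => X; apply: iso_e.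
Qed.

(** * Covers by objects of Hw *)

Section WeightCover.
Variables (R : comPzRingType) (C : tricat R) (w : weight_structure C).
Implicit Types (X Y Z L M N : C).

(** A 0-weight decomposition, rotated: its first term is also in w_{>= 0}, being the fibre of a map
    from w_{>= 0} to w_{>= 1}. *)
Lemma w_cover M : w_ge w 0 M ->
  exists (A : w_heart w) (j : hom (sval A) M) K (k : hom K (sval A))
    (m : hom M (shift C K)), dist k j m /\ w_ge w 0 K.
Proof.
move=> geM; have [L [N [f [g [h [D leL geN]]]]]] := has_dec_all w 0 M.
have geL := w_ge_fiber D geM geN.
have [K [k [m [Dk KN]]]] := dist_fiber D.
exists (exist _ L (conj ((w_le0E w L).1 leL) ((w_ge0E w L).1 geL))), f, K, k, m.
by split=> //; apply: w_ge_unshift; apply: w_ge_iso geN; apply: iso_sym.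
Qed.

Lemma w_heart_le (A : w_heart w) : w_le w 0 (sval A).
Proof. by apply/w_le0E; have [] := svalP A. Qed.

Lemma w_heart_ge (A : w_heart w) : w_ge w 0 (sval A).
Proof. by apply/w_ge0E; have [] := svalP A. Qed.

(** The obstruction lies in C(A, X[1]), zero by weights: objects of Hw are projective relative to
    such triangles. *)
Lemma w_heart_lift (A : w_heart w) X Y Z (f : hom X Y) (g : hom Y Z) h
    (x : hom (sval A) Z) :
  dist f g h -> w_ge w 0 X -> exists y, g \oc y = x.
Proof.
move=> D geX; apply: (dist_lift2 D).
by apply: (w_no_maps _ (w_heart_le A) (w_ge_shift geX)).
Qed.

End WeightCover.

(** * Full faithfulness of the restricted Yoneda functor *)

Section RestrictedYoneda.
Variables (R : comPzRingType) (C : tricat R).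
Variables (satC : saturated C) (w : weight_structure C) (t : t_structure C).
Hypothesis tw : right_adjacent t w.
Implicit Types (X Y Z L : C).

Lemma t_ge_w_ge i X : shifted (t_ge0 t) i X <-> w_ge w i X.
Proof. by split=> -[Y [/tw geY XY]]; exists Y. Qed.

Lemma t_heart_ge (M : t_heart t) : w_ge w 0 (sval M).
Proof. by apply/w_ge0E/tw; have [] := svalP M. Qed.

Lemma t_heart_perp (M : t_heart t) X : w_ge w 1 X -> no_maps X (sval M).
Proof.
by move=> /t_ge_w_ge geX f; apply: t_orth geX _; have [] := svalP M.
Qed.

(** Decompose X[-1] as L -> X[-1] -> N. The first map is zero, so L[1] is a retract of N; but L[1]
    has no maps to N. Hence L[1] = 0 and X[-1] is isomorphic to N. *)
Lemma t_le0_perp X : (forall Y, w_ge w 1 Y -> no_maps Y X) -> t_le0 t X.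
Proof.
move=> pX; have [L [N [f [g [h [D /tw/w_ge0E geL [Y [leY NY]]]]]]]] :=
  t_dec t (unshift C X).
have f0 : f = zero_map _ _.
  suff v : no_maps L (unshift C X) by apply: v.
  apply/no_maps_shift_iff.
  apply: no_maps_iso (iso_refl _) (shift_unshift X) (pX _ _).
  exact: w_ge_shift geL.
have [l hl] : exists l, h \oc l = idm (shift C L).
  by apply: (dist_lift3 D); rewrite f0 shift0 comp0m.
have l0 : no_maps (shift C L) N.
  apply: no_maps_iso (iso_refl _) NY _; apply/no_maps_shift_iff.
  apply: no_maps_iso (iso_refl _) (shift_unshift Y) _ => x.
  apply: t_orth leY; apply/t_ge_w_ge.
  by apply: w_ge_mono (w_ge_shift (w_ge_shift geL)).
have zL : is_zero (shift C L).
  by apply: no_maps_id => x; rewrite -[x]comp1m -hl (l0 l) compm0 comp0m.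
have [r rg] := dist_extend (k := idm _) D (etrans (comp1m _) f0).
have [s gs] := dist_lift2 (k := idm N) D ((zL N).1 _).
have isoN : isomorphic (unshift C X) N.
  exists g, s; split=> //.
  by rewrite -[s]comp1m -rg -(compA r) gs compm1.
apply: t_le0_iso leY; apply: iso_sym.
apply: iso_trans (iso_sym (shift_unshift X)) _.
apply: iso_trans (fmap_iso (shift C) isoN) _.
exact: iso_trans (fmap_iso (shift C) NY) (shift_unshift Y).
Qed.

(** Such an x factors through X[1] in w_{>= 1}, which has no maps to Ht. *)
Lemma cover_faithful (N : t_heart t) X Y Z (f : hom X Y) (g : hom Y Z) h
    (x : hom Z (sval N)) :
  dist f g h -> w_ge w 0 X -> x \oc g = zero_map _ _ -> x = zero_map _ _.
Proof.
move=> D geX xg; have [l <-] := dist_extend2 D xg.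
by rewrite (t_heart_perp (M := N) (w_ge_shift geX) l) comp0m.
Qed.

Local Notation RY := (restricted_yoneda satC w t).

Lemma restricted_yoneda_faithful (M N : t_heart t) (f g : hom M N) :
  fmap RY f = fmap RY g -> f = g.
Proof.
move=> fg.
have fgx (A : w_heart w) (x : hom (sval A) (sval M)) :
    (f : hom (sval M) (sval N)) \oc x = (g : hom (sval M) (sval N)) \oc x.
  exact: (congr1
    (fun n : nat_trans (ry_obj_functor satC w M) (ry_obj_functor satC w N) =>
    (n A : {linear lhom C (sval A) (sval M) -> lhom C (sval A) (sval N)}) x) fg).
have [A [j [K [k [m [D geK]]]]]] := w_cover (t_heart_ge M).
apply: (@subm0_eq R C); apply: (cover_faithful D geK).
by rewrite comp_subl fgx addN_map.
Qed.

(** Take a presentation B -> A -> M by objects of Hw. By naturality u A j vanishes on B, hence on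
    the fibre K that B covers, and so extends to f : M -> N. Lifting along j shows that f induces
    n. *)
Lemma restricted_yoneda_full (M N : t_heart t) (n : hom (RY M) (RY N)) :
  exists f, fmap RY f = n.
Proof.
pose v (A : w_heart w) :
    {linear lhom C (sval A) (sval M) -> lhom C (sval A) (sval N)} :=
  ncomp n A.
pose u (A : w_heart w) (x : hom (sval A) (sval M)) : hom (sval A) (sval N) :=
  v A x.
have un (A B : w_heart w) (a : hom (sval A) (sval B))
    (x : hom (sval B) (sval M)) :
    u A (x \oc a) = u B x \oc a.
  have := @naturality _ _ _ _ n B A a.
  exact: (congr1 (fun f :
    {linear lhom C (sval B) (sval M) -> lhom C (sval A) (sval N)} => f x)).
have [A [j [K [k [m [D geK]]]]]] := w_cover (t_heart_ge M).
have [B [i [K' [k' [m' [D' geK']]]]]] := w_cover geK.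
have uk : u A j \oc k = zero_map _ _.
  apply: (cover_faithful D' geK').
  have := un B A (k \oc i) j; rewrite !compA (dist_comp0 D) comp0m => <-.
  exact: (linear0 (v B)).
have [f fj] := dist_extend D uk.
exists (f : @hom (t_heart t) M N).
apply: nat_transP => A'; apply: linearP_ext => x.
have [y <-] := w_heart_lift (x : hom (sval A') (sval M)) D geK.
transitivity (f \oc (j \oc y)); first by [].
transitivity (u A' (j \oc y)); last by [].
by rewrite compA fj -un.
Qed.

End RestrictedYoneda.

(** * Extension of functors from the heart of w *)

Lemma linear_bijection_inverse (R : comPzRingType) (U V : lmodType R)
    (f : {linear U -> V}) :
  (forall y, exists x, f x = y) -> (forall x, f x = 0 -> x = 0) ->
  exists g : {linear V -> U}, cancel f g /\ cancel g f.
Proof.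
move=> f_surj f_inj; have [g fg] := choice f_surj.
have finj : injective f.
  by move=> x y xy; apply/eqP; rewrite -subr_eq0 (f_inj (x - y)) //
    linearB /= xy subrr.
have glin : linear g.
  by move=> a x y; apply: finj; rewrite linearP !fg.
pose g' := HB.pack_for {linear V -> U} g (GRing.isLinear.Build R V U _ g glin).
by exists g'; split=> x /=; rewrite /g' /=; [apply: finj; rewrite fg | apply: fg].
Qed.

Section CompositionSums.
Variables (R : comPzRingType) (C : lincat R).
Implicit Types X Y Z : C.

Lemma scale1_map X Y (f : hom X Y) : scale_map 1 f = f.
Proof. exact: scale1r. Qed.

Lemma comp_addl X Y Z (g g' : hom Y Z) (f : hom X Y) :
  add_map g g' \oc f = add_map (g \oc f) (g' \oc f).
Proof. by have := compPl 1 g g' f; rewrite !scale1_map. Qed.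

Lemma comp_addr X Y Z (g : hom Y Z) (f f' : hom X Y) :
  g \oc add_map f f' = add_map (g \oc f) (g \oc f').
Proof. by have := compPr 1 g f f'; rewrite !scale1_map. Qed.

Lemma subm_add X Y (f g : hom X Y) : f = add_map g (add_map (opp_map g) f).
Proof. by rewrite /add_map /opp_map addrA subrr add0r. Qed.

End CompositionSums.

Section Extension.
Variables (R : comPzRingType) (cohR : coherent R) (C : tricat R).
Variables (w : weight_structure C) (wb : w_bounded w).
Variables (F : presheaf (w_heart w)) (Flin : linear_presheaf F).
Hypothesis Ffp : forall A, finitely_presented (pobj F A).
Implicit Types (X Y Z V S K M : C) (A B : w_heart w).

(** Typed by morphisms of C, since the maps between objects of Hw below arise as composites through
    other objects. *)
Definition res A B (a : @hom C (sval A) (sval B)) : {linear pobj F B -> pobj F A} :=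
  @pmap R (w_heart w) F A B a.

Lemma res1 A s : res (@idm C (sval A)) s = s.
Proof. exact: (@pmap1 R (w_heart w) F A s). Qed.

Lemma resM A B E (b : @hom C (sval B) (sval E)) (a : @hom C (sval A) (sval B)) s :
  res (b \oc a) s = res a (res b s).
Proof. exact: (@pmapM R (w_heart w) F A B E b a s). Qed.

Lemma resP A B c (a b : @hom C (sval A) (sval B)) s :
  res (add_map (scale_map c a) b) s = c *: res a s + res b s.
Proof. exact: Flin. Qed.

Lemma resD A B (a b : @hom C (sval A) (sval B)) s :
  res (add_map a b) s = res a s + res b s.
Proof. by rewrite -{1}(scale1_map a) resP scale1r. Qed.

Lemma resB A B (a b : @hom C (sval A) (sval B)) s :
  res (add_map (opp_map b) a) s = res a s - res b s.
Proof. by rewrite -scaleN1_map resP scaleN1r addrC. Qed.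

Lemma res0 A B s : res (@zero_map R C (sval A) (sval B)) s = 0.
Proof.
by have := resP (-1) (zero_map (sval A) (sval B)) (zero_map _ _) s;
  rewrite scale_map0 add_map0 scaleN1r addNr.
Qed.

(* A natural transformation from C(-, V), restricted to the heart, to F. *)
Definition family V (e : forall A, @hom C (sval A) V -> pobj F A) :=
  forall A B (a : @hom C (sval A) (sval B)) (y : hom (sval B) V),
    e A (y \oc a) = res a (e B y).

(** Additivity comes for free: x and y lift to a cover j : B -> V, on which e acts by restricting
    the single element e B j, and F is linear. *)
Lemma family_add V e A (x y : hom (sval A) V) :
  w_ge w 0 V -> family e -> e A (add_map x y) = e A x + e A y.
Proof.
move=> geV fe; have [B [j [K [k [m [D geK]]]]]] := w_cover geV.
have [x' <-] := w_heart_lift x D geK; have [y' <-] := w_heart_lift y D geK.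
by rewrite -comp_addr !fe resD.
Qed.

Lemma family0 V e A : w_ge w 0 V -> family e -> e A (zero_map (sval A) V) = 0.
Proof.
move=> geV fe; have := family_add (zero_map (sval A) V) (zero_map _ _) geV fe.
by rewrite add_map0 => /eqP; rewrite -subr_eq subrr => /eqP.
Qed.

(* For A in the heart, C(A, S) -> C(A, V) is onto and its kernel is the image of
   C(A, K). *)
Lemma family_descend K S V (f : hom K S) (g : hom S V) h e :
  dist f g h -> w_ge w 0 K -> w_ge w 0 S -> family e ->
  (forall A (x : hom (sval A) K), e A (f \oc x) = 0) ->
  exists e', family e' /\ forall A (y : hom (sval A) S), e' A (g \oc y) = e A y.
Proof.
move=> D geK geS fe ef.
pose l A (y : hom (sval A) V) := projT1 (cid (w_heart_lift y D geK)).
have gl A (y : hom (sval A) V) : g \oc l A y = y.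
  exact: projT2 (cid (w_heart_lift y D geK)).
have el A (y : hom (sval A) S) : e A (l A (g \oc y)) = e A y.
  have [|x fx] := dist_lift (k := add_map (opp_map y) (l A (g \oc y))) D.
    by rewrite comp_subr gl addN_map.
  by rewrite (subm_add (l A (g \oc y)) y) family_add // -fx ef addr0.
exists (fun A y => e A (l A y)); split=> // A B a y.
by rewrite -{1}(gl B y) -compA el fe.
Qed.

(* u is the weight truncation X -> w_{>= 0} X, j a cover of its target with
   fibre k, and v the part of w_{>= 0} X -> (w_{<= -1} X)[1] seen by the heart. *)
Record resolution X := Resolution {
  rt : C;
  ru : hom X rt;
  rA : w_heart w;
  rj : hom (sval rA) rt;
  rK : C;
  rk : hom rK (sval rA);
  rm : hom rt (shift C rK);
  rB : w_heart w;
  rv : hom rt (sval rB);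
  r_geT : w_ge w 0 rt;
  r_geK : w_ge w 0 rK;
  r_dist : dist rk rj rm;
  r_vu : rv \oc ru = zero_map _ _;
  r_ext : forall W (x : hom X W), w_ge w 0 W -> exists x', x' \oc ru = x;
  r_fac : forall W (x : hom rt W), w_ge w 0 W -> x \oc ru = zero_map _ _ ->
    exists b, b \oc rv = x }.

Lemma resolution_exists X : exists _ : resolution X, True.
Proof.
have [L [T [f [u [h [D leL geT]]]]]] := has_dec_all w (-1) X.
have [A [j [K [k [m [Dj geK]]]]]] := w_cover geT.
have [L' [B [f' [g' [h' [D' leL' geB]]]]]] := has_dec_all w (-1) (shift C L).
(* L[1] is in w_{<= 0} and L' in w_{<= -1}, so B = w_{>= 0} (L[1]) lies in the heart. *)
have leB : w_le w 0 B.
  by apply: (w_le_cone (i := 0) D' leL'); apply: w_le_shift leL.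
pose B' : w_heart w := exist _ B (conj ((w_le0E w B).1 leB) ((w_ge0E w B).1 geB)).
apply: (ex_intro _
  (@Resolution X T u A j K k m B' (g' \oc h) geT geK Dj _ _ _)) => //.
- by rewrite -compA (dist_comp02 D) compm0.
- move=> W x geW; apply: (dist_extend D).
  exact: (w_no_maps (w := w) _ leL geW).
- move=> W x geW xu; have [y <-] := dist_extend2 D xu.
  have [|b <-] := dist_extend (k := y) D'; last by exists b; rewrite compA.
  exact: (w_no_maps (w := w) _ leL' geW).
Qed.

Definition resol X : resolution X := projT1 (cid (resolution_exists X)).

Notation T_ X := (rt (resol X)).
Notation u_ X := (ru (resol X)).
Notation A_ X := (rA (resol X)).
Notation j_ X := (rj (resol X)).
Notation B_ X := (rB (resol X)).
Notation v_ X := (rv (resol X)).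

Lemma rj_lift X A (x : hom (sval A) (T_ X)) : exists y, j_ X \oc y = x.
Proof. exact: w_heart_lift x (r_dist _) (r_geK _). Qed.

Definition cocycle X (s : pobj F (A_ X)) : Prop :=
  forall A (a : hom (sval A) (sval (A_ X))),
    j_ X \oc a = zero_map _ _ -> res a s = 0.

Definition bdry X : {linear pobj F (B_ X) -> pobj F (A_ X)} :=
  res (v_ X \oc j_ X).

(** A map killed by j factors through K, hence through a cover of K by an object of Hw. So a single
    condition defines the cocycles, as the kernel of a map of finitely presented modules. *)
Lemma cocycle_fin_gen X : fin_gen (@cocycle X).
Proof.
have [A [i [K [k [m [D geK]]]]]] := w_cover (r_geK (resol X)).
have fg := fin_gen_ker cohR (res (rk (resol X) \oc i)) (Ffp _) (Ffp _).
apply: (fin_gen_image (f := idfun) fg) => s; split=> [cs|[s' /= cs <-] B b jb].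
  by exists s => //; apply: cs; rewrite compA (dist_comp0 (r_dist _)) comp0m.
have [c <-] := dist_lift (r_dist _) jb; have [c' <-] := w_heart_lift c D geK.
by rewrite compA resM cs linear0.
Qed.

Definition cocycle_rank X := projT1 (cid (cocycle_fin_gen X)).
Definition cocycle_gen X : {linear 'rV[R]_(cocycle_rank X) -> pobj F (A_ X)} :=
  projT1 (cid (projT2 (cid (cocycle_fin_gen X)))).

Lemma cocycleP X s : @cocycle X s <-> exists z, cocycle_gen X z = s.
Proof. exact: (projT2 (cid (projT2 (cid (cocycle_fin_gen X))))). Qed.

Definition class_map X : {linear 'rV[R]_(cocycle_rank X) -> coker_mod (bdry X)} :=
  lin_comp (coker_proj (bdry X)) (cocycle_gen X).

(* The cocycles modulo the boundaries; the cocycles enter as the image of a free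
   module so that image_mod applies. *)
Definition ext_mod X : lmodType R := image_mod (class_map X).

Definition represents X (y : ext_mod X) s :=
  cocycle s /\ image_val y = coker_proj (bdry X) s.

Lemma ext_repr X (y : ext_mod X) : exists s, represents y s.
Proof.
have [z zy] := image_modP y; exists (cocycle_gen X z); split=> //.
by apply/cocycleP; exists z.
Qed.

Lemma ext_class X s : cocycle s -> exists y : ext_mod X, represents y s.
Proof.
move=> cs; have [z zs] := (cocycleP s).1 cs; exists (to_image (class_map X) z).
by split=> //=; rewrite zs.
Qed.

Lemma represents_inj X (y y' : ext_mod X) s :
  represents y s -> represents y' s -> y = y'.
Proof. by move=> [_ ys] [_ ys']; apply: image_val_inj; rewrite ys. Qed.

(** A relation rather than a function, because lifts to the resolutions are unique only up to
    boundaries. *)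
Definition covers X Y (f : hom X Y) (b : hom (sval (A_ X)) (sval (A_ Y))) :=
  exists f' : hom (T_ X) (T_ Y), f' \oc u_ X = u_ Y \oc f /\ j_ Y \oc b = f' \oc j_ X.

Lemma covers_exists X Y (f : hom X Y) : exists b, covers f b.
Proof.
have [f' f'u] := r_ext (resol X) (u_ Y \oc f) (r_geT _).
by have [b bE] := rj_lift (f' \oc j_ X); exists b, f'.
Qed.

Lemma covers1 X : covers (idm X) (idm _).
Proof. by exists (idm _); rewrite !comp1m !compm1. Qed.

Lemma coversM X Y Z (g : hom Y Z) (f : hom X Y) b a :
  covers g b -> covers f a -> covers (g \oc f) (b \oc a).
Proof.
move=> [g' [gu gj]] [f' [fu fj]]; exists (g' \oc f'); split.
  by rewrite -compA fu !compA gu.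
by rewrite compA gj -!compA fj.
Qed.

Lemma coversP X Y c (f g : hom X Y) a b :
  covers f a -> covers g b ->
  covers (add_map (scale_map c f) g) (add_map (scale_map c a) b).
Proof.
move=> [f' [fu fj]] [g' [gu gj]]; exists (add_map (scale_map c f') g').
by rewrite compPl compPr compPl compPr fu gu fj gj.
Qed.

Lemma covers_cocycle X Y (f : hom X Y) b s :
  covers f b -> cocycle s -> cocycle (res b s).
Proof.
move=> [f' [fu fj]] cs A a ja; rewrite -resM; apply: cs.
by rewrite compA fj -compA ja compm0.
Qed.

Lemma bdry_factor X B (x : hom (T_ X) (sval B)) s :
  x \oc u_ X = zero_map _ _ -> exists t, bdry X t = res (x \oc j_ X) s.
Proof.
move=> xu; have [b <-] := r_fac (w_heart_ge B) xu.
by exists (res b s); rewrite -compA !resM -resM.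
Qed.

Lemma covers_bdry X Y (f : hom X Y) b t :
  covers f b -> exists t', bdry X t' = res b (bdry Y t).
Proof.
move=> [f' [fu fj]]; have [|t' tE] := @bdry_factor X (B_ Y) (v_ Y \oc f') t.
  by rewrite -compA fu compA r_vu comp0m.
by exists t'; rewrite tE -resM -!compA fj.
Qed.

(** The difference a' - b' kills u, so it is [x \oc v]; lift x to y : B_X -> A_Y. Then a - b differs
    from y v j by a map killed by [j_ Y], which the cocycle s does not see, and F(y v j) s is a
    boundary. *)
Lemma covers_uniq X Y (f : hom X Y) a b s :
  covers f a -> covers f b -> cocycle s ->
  coker_proj (bdry X) (res a s) = coker_proj (bdry X) (res b s).
Proof.
move=> [a' [au aj]] [b' [bu bj]] cs.
have [|x xv] := @r_fac _ (resol X) _ (add_map (opp_map b') a') (r_geT _).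
  by rewrite comp_subl au bu addN_map.
have [y yx] := rj_lift x.
apply: coker_proj_eq; exists (res y s); apply/eqP; rewrite eq_sym -subr_eq0 /bdry.
rewrite -resM -resB -resB; apply/eqP/cs.
rewrite comp_subr (compA (j_ Y)) yx compA xv comp_subl comp_subr aj bj.
exact: addN_map.
Qed.

Lemma ext_map_subproof X Y (b : hom (sval (A_ X)) (sval (A_ Y))) :
  (forall t, exists t', bdry X t' = res b (bdry Y t)) ->
  forall t, lin_comp (coker_proj (bdry X)) (res b) (bdry Y t) = 0.
Proof. by move=> db t; apply/coker_proj_eq0; apply: db. Qed.

Definition lift_map X Y (f : hom X Y) : hom (sval (A_ X)) (sval (A_ Y)) :=
  projT1 (cid (covers_exists f)).

Lemma lift_mapP X Y (f : hom X Y) : covers f (lift_map f).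
Proof. exact: projT2 (cid (covers_exists f)). Qed.

Definition ext_coker_map X Y (f : hom X Y) :
    {linear coker_mod (bdry Y) -> coker_mod (bdry X)} :=
  coker_lift (ext_map_subproof (fun t => covers_bdry t (lift_mapP f))).

Lemma ext_coker_mapE X Y (f : hom X Y) s :
  ext_coker_map f (coker_proj (bdry Y) s) =
  coker_proj (bdry X) (res (lift_map f) s).
Proof.
exact: (coker_lift_proj
  (ext_map_subproof (fun t => covers_bdry t (lift_mapP f))) s).
Qed.

Lemma ext_fmap_subproof X Y (f : hom X Y) z :
  exists z', class_map X z' = ext_coker_map f (class_map Y z).
Proof.
have cz : cocycle (cocycle_gen Y z) by apply/cocycleP; exists z.
have [z' z'E] := (cocycleP _).1 (covers_cocycle (lift_mapP f) cz).
exists z'; have := ext_coker_mapE f (cocycle_gen Y z).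
by rewrite -z'E => e; exact: (esym e).
Qed.

Definition ext_fmap X Y (f : hom X Y) : {linear ext_mod Y -> ext_mod X} :=
  image_map (ext_fmap_subproof f).

Lemma ext_fmapE X Y (f : hom X Y) b (y : ext_mod Y) s :
  covers f b -> represents y s -> represents (ext_fmap f y) (res b s).
Proof.
move=> fb [cs ys]; split; first exact: covers_cocycle fb cs.
by rewrite image_mapE ys ext_coker_mapE; apply: covers_uniq (lift_mapP f) fb cs.
Qed.

Lemma ext_fmap1 X : ext_fmap (idm X) = @idm (Mod R) (ext_mod X).
Proof.
apply: linearP_ext => y; have [s ys] := ext_repr y.
by apply: represents_inj (ext_fmapE (covers1 X) ys) _; rewrite res1.
Qed.

Lemma ext_fmapM X Y Z (g : hom Y Z) (f : hom X Y) :
  ext_fmap (g \oc f) = @comp (Mod R) _ _ _ (ext_fmap f) (ext_fmap g).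
Proof.
apply: linearP_ext => y; have [s ys] := ext_repr y.
have [b fb] := covers_exists f; have [c gc] := covers_exists g.
apply: represents_inj (ext_fmapE (coversM gc fb) ys) _.
by rewrite resM; apply/(ext_fmapE fb)/ext_fmapE.
Qed.

Definition extension : presheaf C :=
  @Functor (op_cat C) (Mod R) ext_mod (fun X Y f => ext_fmap f) ext_fmap1
    (fun X Y Z g f => ext_fmapM f g).

Lemma representsP X c (y y' : ext_mod X) s s' :
  represents y s -> represents y' s' ->
  represents (c *: y + y') (c *: s + s').
Proof.
move=> [cs ys] [cs' ys']; split; last by rewrite image_val_linear ys ys' linearP.
by move=> A a ja; rewrite linearP (cs A a ja) (cs' A a ja) scaler0 addr0.
Qed.

Lemma extension_linear : linear_presheaf extension.
Proof.
move=> X Y c f g y; have [s ys] := ext_repr y.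
have [a fa] := covers_exists f; have [b gb] := covers_exists g.
apply: represents_inj (ext_fmapE (coversP c fa gb) ys) _.
by rewrite resP; apply: representsP; apply: ext_fmapE.
Qed.

Lemma represents0 X (y : ext_mod X) : represents y 0 -> y = 0.
Proof.
by move=> [_ y0]; apply: image_val_inj; rewrite y0 image_val0 linear0.
Qed.

(** Here u is zero, so the zero map covers the identity and every class is represented by 0. *)
Lemma extension_vanish_le X (y : ext_mod X) : w_le w (-1) X -> y = 0.
Proof.
move=> leX; have [s ys] := ext_repr y; apply: represents0.
have c0 : covers (idm X) (zero_map (sval (A_ X)) (sval (A_ X))).
  exists (zero_map _ _); rewrite !comp0m !compm0 compm1; split=> //.
  by apply/esym/(w_no_maps (w := w) _ leX (r_geT _)).
by have := ext_fmapE c0 ys; rewrite res0 ext_fmap1.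
Qed.

(** The identity of X extends along u to r, and [r \oc j] vanishes by weights; so zero again covers
    the identity. *)
Lemma extension_vanish_ge X (y : ext_mod X) : w_ge w 1 X -> y = 0.
Proof.
move=> geX; have [s ys] := ext_repr y; apply: represents0.
have [r ru] := r_ext (resol X) (idm X) (w_ge_mono ler01 geX).
have c0 : covers (idm X) (zero_map (sval (A_ X)) (sval (A_ X))).
  exists (u_ X \oc r); rewrite compm0 -!compA ru; split=> //.
  rewrite [r \oc _](w_no_maps (w := w) _ (w_heart_le _) geX) ?compm0 //.
by have := ext_fmapE c0 ys; rewrite res0 ext_fmap1.
Qed.

Lemma extension_vanish M : exists a b : int, forall i : int,
  i < a \/ b < i -> forall x : pobj extension (shiftz (- i) M), x = 0.
Proof.
have [a geM] := wb.1 M; have [b leM] := wb.2 M.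
exists a, b => i [lt_i|lt_i] x.
  by apply: extension_vanish_ge; apply: w_ge_mono (w_ge_shiftz (- i) geM); lia.
by apply: extension_vanish_le; apply: w_le_mono (w_le_shiftz (- i) leM); lia.
Qed.

Lemma extension_fp M : finitely_presented (pobj extension M).
Proof.
apply: (fp_image cohR).
  by exists _, idfun => y; split=> // _; exists y.
apply: (fp_quotient (d := bdry M) (p := coker_proj (bdry M)) cohR).
- exact/fp_fin_gen/Ffp.
- exact: Ffp.
- exact: coker_proj_surj.
- exact: coker_proj_eq0.
Qed.

Lemma biproduct_w_ge i X Y S (a : hom X S) (b : hom Y S) (p : hom S X) (q : hom S Y) :
  add_map (a \oc p) (b \oc q) = idm S -> w_ge w i X -> w_ge w i Y -> w_ge w i S.
Proof.
move=> e geX geY; rewrite -(subrK 1 i); apply: w_ge_perp => L leL x.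
rewrite -[x]comp1m -e comp_addl -!compA.
rewrite (w_no_maps (w := w) _ leL geX (p \oc x)); last by lia.
rewrite (w_no_maps (w := w) _ leL geY (q \oc x)); last by lia.
by rewrite !compm0 add_map0.
Qed.

(* If the class of s on Y restricts to the boundary of b on X, then s - b is a
   family on T_Y + B_X which vanishes on T_X, and hence descends to the cone V
   of T_X -> T_Y + B_X; the map from the cone of X -> Y to V gives the class. *)
Lemma extension_exact X Y Z (f : hom X Y) (g : hom Y Z) (h : hom Z (shift C X))
    (y : ext_mod Y) :
  dist f g h -> ext_fmap f y = 0 -> exists z, ext_fmap g z = y.
Proof.
move=> D fy; have [s ys] := ext_repr y; have cs := ys.1.
have [a fa] := covers_exists f; have [f' [fu fj]] := fa.
have [b bE] : exists b, bdry X b = res a s.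
  apply/coker_proj_eq0; have [_ <-] := ext_fmapE fa ys.
  by rewrite fy image_val0.
have [e [fe ej]] : exists e, family e /\
    forall A (x : hom (sval A) _), e A (j_ Y \oc x) = res x s.
  apply: (family_descend (e := fun A x => res x s) (r_dist (resol Y))) => //.
  - exact: r_geK.
  - exact: w_heart_ge.
  - by move=> A B x x'; apply: resM.
  - by move=> A x; apply: cs; rewrite compA (dist_comp0 (r_dist _)) comp0m.
have [S [i1 [i2 [p1 [p2 [p11 p22 p21 p12 pS]]]]]] :=
  tc_biproduct (T_ Y) (sval (B_ X)).
have geS := biproduct_w_ge pS (r_geT _) (w_heart_ge _).
pose phi := add_map (i1 \oc f') (i2 \oc v_ X).
have p1phi : p1 \oc phi = f'.
  by rewrite comp_addr !compA p11 p12 comp1m comp0m add_map0.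
have p2phi : p2 \oc phi = v_ X.
  by rewrite comp_addr !compA p22 p21 comp1m comp0m add0_map.
pose eS A (x : hom (sval A) S) := e A (p1 \oc x) - res (p2 \oc x) b.
have feS : family eS.
  by move=> A B x x'; rewrite /eS !compA fe resM linearB.
have [V [c [d Dphi]]] := dist_cone phi.
have geV : w_ge w 0 V.
  by apply: (w_ge_cone Dphi) geS; apply: w_ge_mono (r_geT _).
have [|eV [feV eVc]] := family_descend Dphi (r_geT _) geS feS.
  move=> A x; have [x' <-] := rj_lift x; rewrite /eS (compA p1) (compA p2) p1phi p2phi.
  by rewrite !compA -fj -compA ej !resM -bE subrr.
have [z [zg _]] : exists z, z \oc g = c \oc (i1 \oc u_ Y) /\
    fmap (shift C) (u_ X) \oc h = d \oc z.
  apply: (dist_mor D Dphi).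
  by rewrite comp_addl -!compA r_vu compm0 add_map0 fu.
have [z' z'u] := r_ext (resol Z) z geV.
pose sZ := eV (A_ Z) (z' \oc j_ Z).
have csZ : cocycle sZ.
  by move=> A x jx; rewrite -feV -compA jx compm0; apply: family0.
have [yZ yZs] := ext_class csZ; exists yZ.
have [k [g' [gu gj]]] := covers_exists g.
apply: represents_inj (ext_fmapE _ yZs) _.
  by exists g'; split; [exact: gu | exact: gj].
rewrite -feV -compA gj compA.
(* The maps z' g' and c i1 agree on Y, so they differ by a map through v, which changes the class
   only by a boundary. *)
have [|x xv] := @r_fac _ (resol Y) _ (add_map (opp_map (c \oc i1)) (z' \oc g')) geV.
  by rewrite comp_subl -!compA gu (compA z') z'u zg addN_map.
rewrite (subm_add (z' \oc g') (c \oc i1)) -xv comp_addl family_add //.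
have -> : eV (A_ Y) (c \oc i1 \oc j_ Y) = s.
  rewrite -compA eVc /eS !compA p11 p21 comp1m comp0m res0 subr0.
  by rewrite -[j_ Y]compm1 ej res1.
split.
  move=> A x' jx; rewrite linearD (cs _ _ jx) add0r -feV -!compA jx !compm0.
  exact: family0.
rewrite linearD ys.2 -[LHS]addr0; congr (_ + _); apply/esym/coker_proj_eq0.
by exists (eV _ x); rewrite -compA feV.
Qed.

Lemma extension_finite : finite_functor extension.
Proof.
split.
- exact: extension_linear.
- move=> X Y Z f g h D y; split=> [fy|[z <-]]; first exact: extension_exact D fy.
  rewrite -pmapM (dist_comp0 D).
  have := extension_linear (-1) (zero_map X Z) (zero_map X Z) z.
  by rewrite scale_map0 add_map0 scaleN1r addNr.
- exact: extension_fp.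
- exact: extension_vanish.
Qed.

(** Restricting representatives along this lift compares the extension with F on Hw; boundaries go
    to zero because v u = 0. *)
Definition heart_unit A : hom (sval A) (sval (A_ (sval A))) :=
  projT1 (cid (rj_lift (u_ (sval A)))).

Lemma heart_unitP A : j_ (sval A) \oc heart_unit A = u_ (sval A).
Proof. exact: projT2 (cid (rj_lift (u_ (sval A)))). Qed.

Lemma heart_unit_bdry A t : res (heart_unit A) (bdry (sval A) t) = 0.
Proof. by rewrite -resM -compA heart_unitP r_vu res0. Qed.

Definition ext_eval_fun A (y : ext_mod (sval A)) : pobj F A :=
  coker_lift (@heart_unit_bdry A) (image_val y).

Lemma ext_eval_is_linear A : linear (@ext_eval_fun A).
Proof.
by move=> c y y'; rewrite /ext_eval_fun image_val_linear linearP.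
Qed.

HB.instance Definition _ A :=
  GRing.isLinear.Build R (ext_mod (sval A)) (pobj F A) _ (@ext_eval_fun A)
    (@ext_eval_is_linear A).

Definition ext_eval A : {linear ext_mod (sval A) -> pobj F A} := @ext_eval_fun A.

Lemma ext_evalE A (y : ext_mod (sval A)) s :
  represents y s -> ext_eval A y = res (heart_unit A) s.
Proof.
move=> [_ ys]; rewrite /ext_eval /= /ext_eval_fun ys.
exact: (coker_lift_proj (@heart_unit_bdry A)).
Qed.

Lemma ext_eval_nat A B (a : @hom C (sval A) (sval B)) (y : ext_mod (sval B)) :
  ext_eval A (ext_fmap a y) = res a (ext_eval B y).
Proof.
have [s ys] := ext_repr y; have [b [a' [au aj]]] := covers_exists a.
have cb : covers a b by exists a'.
rewrite (ext_evalE (ext_fmapE cb ys)) (ext_evalE ys) -!resM.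
apply/eqP; rewrite -subr_eq0 -resB; apply/eqP/ys.1.
by rewrite comp_subr !compA heart_unitP aj -(compA a') heart_unitP au addN_map.
Qed.

Lemma heart_retraction A : exists r, r \oc u_ (sval A) = idm (sval A).
Proof. exact: r_ext (w_heart_ge A). Qed.

Lemma ext_eval_inj A (y : ext_mod (sval A)) : ext_eval A y = 0 -> y = 0.
Proof.
have [s ys] := ext_repr y; rewrite (ext_evalE ys) => s0; apply: represents0.
have [r ru] := heart_retraction A.
(* This other lift of the identity passes through A, so the class is determined by its value in
   F(A). *)
have cb : covers (idm (sval A)) (heart_unit A \oc (r \oc j_ (sval A))).
  exists (u_ (sval A) \oc r); split; first by rewrite -compA ru.
  by rewrite compA heart_unitP compA.
by have := ext_fmapE cb ys; rewrite resM s0 linear0 ext_fmap1.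
Qed.

Lemma ext_eval_surj A s : exists y, ext_eval A y = s.
Proof.
have [r ru] := heart_retraction A.
have cs : cocycle (res (r \oc j_ (sval A)) s).
  by move=> B b jb; rewrite -resM -compA jb compm0 res0.
have [y ys] := ext_class cs; exists y.
by rewrite (ext_evalE ys) -resM -compA heart_unitP ru res1.
Qed.

End Extension.

Lemma nat_transformation_iso (C D : category) (F G : functor C D)
    (a : nat_trans F G) :
  (forall X, is_iso (a X)) -> @isomorphic (functor_cat C D) F G.
Proof.
move=> isoa; pose b X := projT1 (cid (isoa X)).
have bP X : is_inverse (a X) (b X) := projT2 (cid (isoa X)).
have nat X Y (f : hom X Y) : b Y \oc fmap G f = fmap F f \oc b X.
  rewrite -[LHS]compm1 -(bP X).2 -compA (compA _ (a X)) -naturality !compA.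
  by rewrite (bP Y).1 comp1m.
by exists a, (NatTrans nat); split; apply: nat_transP => X; case: (bP X).
Qed.

(** * Essential surjectivity of the restricted Yoneda functor *)

Section EssentialImage.
Variables (R : comPzRingType) (cohR : coherent R) (C : tricat R).
Variables (satC : saturated C) (w : weight_structure C) (wb : w_bounded w).
Variables (t : t_structure C) (tw : right_adjacent t w).

Lemma restricted_yoneda_ess_surj (F : FunR (w_heart w)) :
  exists M, isomorphic (restricted_yoneda satC w t M) F.
Proof.
case: F => F Flin; pose F' : presheaf (w_heart w) := fcomp (@incl (Mod R) _) F.
have Ffp (A : w_heart w) : finitely_presented (pobj F' A) := svalP (F A).
have [M isoM] := (satC _).2 (extension_finite cohR wb Flin Ffp).
have [b [a [ab ba an]]] := presheaf_isoP isoM.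
(* M represents the extension of F: its vanishing on w_{<= -1} puts M in w_{>= 0}, and its vanishing
   on w_{>= 1} puts M in [t_le0]. *)
have geM : w_ge0 w M.
  apply/w_ge0E; rewrite -[0](subrK 1); apply: w_ge_perp => L leL x.
  by rewrite -[x]ba (extension_vanish_le Flin (a L x) leL); exact: linear0.
have leM : t_le0 t M.
  apply: (t_le0_perp tw) => L geL x.
  by rewrite -[x]ba (extension_vanish_ge Flin (a L x) geL); exact: linear0.
pose M' : t_heart t := exist _ M (conj leM ((tw M).2 geM)); exists M'.
pose v (A : w_heart w) := ext_eval cohR Flin Ffp A.
pose n (A : w_heart w) : {linear lhom C (sval A) M -> pobj F' A} :=
  lin_comp (v A) (a (sval A)).
have a_nat X Y (f : hom X Y) y :
    a X (pmap (yoneda M) f y) = pmap (extension cohR Flin Ffp) f (a Y y).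
  by rewrite -{1}[y]ba -an ab.
pose Y := ry_obj_functor satC w M'.
have nat (A B : op_cat (w_heart w)) (f : hom A B) :
    @comp (fpMod R) (Y A) (Y B) (F B) (n B) (fmap Y f) =
    @comp (fpMod R) (Y A) (F A) (F B) (fmap F f) (n A).
  apply: linearP_ext => x.
  transitivity (v B (a (sval B) (pmap (yoneda M) (f : @hom C (sval B) (sval A)) x))).
    by [].
  rewrite a_nat.
  exact: (ext_eval_nat Flin (f : @hom C (sval B) (sval A)) (a (sval A) x)).
apply: (@nat_transformation_iso _ _ Y F
  (@NatTrans (op_cat (w_heart w)) (fpMod R) Y F n nat)) => A.
have [||g [ng gn]] := @linear_bijection_inverse R _ _ (n A).
- move=> s; have [y <-] := ext_eval_surj cohR Flin Ffp (A := A) s.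
  by exists (b (sval A) y); rewrite /n /= ab.
- move=> x /(ext_eval_inj (Flin := Flin)) ax; rewrite -[x]ba ax; exact: linear0.
by exists g; split; apply: linearP_ext.
Qed.

End EssentialImage.

Theorem corollary4p1p4 (R : comPzRingType) (cohR : coherent R)
    (C : tricat R) (satC : saturated C)
    (w : weight_structure C) (wb : w_bounded w) :
  (forall (D : weight_decs w) (i : int) (M : C),
     representable (tau_le D (yoneda M) i) /\
     representable (tau_ge D (yoneda M) i)) /\
  (exists t : t_structure C, right_adjacent t w /\
     ((exists G : C, densely_generated G) -> t_bounded t)) /\
  (forall t : t_structure C, right_adjacent t w ->
     is_equivalence (restricted_yoneda satC w t)).
Proof.
split; first exact: tau_representable.
split.
  exists (adjacent_t_structure cohR satC wb); split=> // -[G].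
  exact: adjacent_t_bounded.
move=> t tw; apply: fully_faithful_equivalence.
- exact: restricted_yoneda_faithful.
- exact: restricted_yoneda_full.
- exact: restricted_yoneda_ess_surj.
Qed.
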